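(* Let $M$ be a complete metric space of curvature bounded above by $\kappa\in\mathbb R$, and let $f\colon M\to\mathbb R^N$ be Lipschitz with Lipschitz constant $L_f\ge0$ (with respect to the $\infty$-norm on $\mathbb R^N$). Let $0<\delta\le\rho_M^\kappa$ and fix $\rho$ with $\delta\le\rho\le\rho_M^\kappa$; assume $\mathcal J_M^\rho>0$. Let $\epsilon_{\mathrm{met}}\ge0$ satisfy $$\epsilon_{\mathrm{met}}\le\rho-\delta\quad\text{and}\quad \epsilon_{\mathrm{met}}\le\frac{1-\mathcal J_M^\rho}{1+\mathcal J_M^\rho}\,\delta,$$ and let $\epsilon_{\mathrm{fun}}\ge0$. Then for every metric space $\mathbb M$ with a not necessarily continuous map $\mathbb f\colon\mathbb M\to\mathbb R^N$, any $(\epsilon_{\mathrm{met}},\epsilon_{\mathrm{fun}})$-correspondence between $(\mathbb M,\mathbb f)$ and $(M,f)$ induces an interleaving $$\mathcal R^\delta(\mathbb M^\bullet)\simeq_{L_f\,\mathcal L_M^\rho\,\epsilon_{\mathrm{met}}+\epsilon_{\mathrm{fun}}}\mathcal R^\delta(M^\bullet)$$ in the persistent homotopy category $\mathrm{ho}(\mathrm{Top}^{\mathbb R^N})$ (i.e. whenever such a correspondence exists, such an interleaving exists).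
   Context: Geometry. For $\kappa\in\mathbb R$, $M_\kappa$ is the 2-sphere of radius $1/\sqrt\kappa$ with geodesic distance ($\kappa>0$), the Euclidean plane ($\kappa=0$), or the hyperbolic plane with metric rescaled by $1/\sqrt{-\kappa}$ ($\kappa<0$); $\varpi_\kappa$ is its diameter ($\pi/\sqrt\kappa$ if $\kappa>0$, else $\infty$). A metric space is $\mathrm{CAT}(\kappa)$ if any two points at distance $<\varpi_\kappa$ are joined by a geodesic and, for every geodesic triangle of perimeter $<2\varpi_\kappa$, the geodesic-preserving map from its comparison triangle in $M_\kappa$ (same side lengths) to it is $1$-Lipschitz. $M$ has curvature bounded above by $\kappa$ if every point has a neighborhood that is a $\mathrm{CAT}(\kappa)$ space. With $\overline B_r(x)$ the closed ball, $\rho_M^\kappa:=\inf_{x\in M}\min\{\sup\{r>0\mid \overline B_r(x)\text{ is }\mathrm{CAT}(\kappa)\},\varpi_\kappa/2\}$. Jung constant. For a finite nonempty $A\subset M$, the circumradius $\mathfrak R(A)$ is the minimum over $x\in M$ of $\max_{a\in A}d(x,a)$ (for complete $M$ of curvature bounded above by $\kappa$ and $\mathrm{diam}(A)<\rho_M^\kappa$ it is attained at a unique point). For $0<\rho\le\rho_M^\kappa$, $\mathcal J_M^\rho:=\sup\{\mathfrak R(A)/\mathrm{diam}(A)\mid A\subset M\text{ finite},\ 0<\mathrm{diam}(A)<\rho\}$ (supremum in $\mathbb R_{\ge0}$, so $0$ for the empty family). One has $\mathcal J_M^\rho\le1$. $\mathcal L_M^\rho:=\frac{2\mathcal J_M^\rho}{1-\mathcal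 J_M^\rho}$; if $\mathcal J_M^\rho=1$ then $\epsilon_{\mathrm{met}}=0$ is forced and $\mathcal L_M^\rho\cdot0:=0$. Persistent homotopy. $N\ge0$; $\mathbb R^N$ carries the componentwise partial order and is viewed as a category. $\mathrm{ho}(\mathrm{Top}^{\mathbb R^N})$ is the localization of the category of functors $\mathbb R^N\to\mathrm{Top}$ at the objectwise weak homotopy equivalences. $F^{\bullet+\varepsilon}$ is the precomposition of $F^\bullet$ with $u\mapsto u+(\varepsilon,\dots,\varepsilon)$, and $s$ denotes structure maps $F^\bullet\to F^{\bullet+\varepsilon}$. An $\varepsilon$-interleaving $F^\bullet\simeq_\varepsilon G^\bullet$ in the persistent homotopy category consists of morphisms $\varphi\colon F^\bullet\to G^{\bullet+\varepsilon}$, $\psi\colon G^\bullet\to F^{\bullet+\varepsilon}$ in $\mathrm{ho}(\mathrm{Top}^{\mathbb R^N})$ with $\psi^{+\varepsilon}\circ\varphi=s$ and $\varphi^{+\varepsilon}\circ\psi=s$ there. For a metric space $X$ with function $g\colon X\to\mathbb R^N$, $X^u=\{x\mid g(x)\le u\}$. $\mathcal R^\delta(X)$ is the simplicial complex of finite nonempty subsets of $X$ with all pairwise distances (including $d(x,x)=0$) $<\delta$; $\mathcal R^\delta(X^\bullet)$ is the functor $u\mapsto\mathcal R^\delta(X^u)$ (inclusions), regarded as space-valued via geometric realization. Correspondences. An $(\epsilon_{\mathrm{met}},\epsilon_{\mathrm{fun}})$-correspondence between $(\mathbb M_0,\mathbb f_0)$ and $(\mathbb M_1,\mathbb f_1)$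 is a subset $\mathfrak C\subset\mathbb M_0\times\mathbb M_1$ projecting onto both factors with $|d(x,x')-d(y,y')|\le\epsilon_{\mathrm{met}}$ for all $(x,y),(x',y')\in\mathfrak C$ and $\|\mathbb f_0(x)-\mathbb f_1(y)\|_\infty\le\epsilon_{\mathrm{fun}}$ for all $(x,y)\in\mathfrak C$. *)

(* Defs.v *)
From HB Require Import structures.
From mathcomp Require Import all_boot all_order all_algebra finmap.
From mathcomp Require Import all_classical all_reals all_analysis.

Set Implicit Arguments.
Unset Strict Implicit.
Unset Printing Implicit Defensive.

Import Order.TTheory GRing.Theory Num.Theory.
Import numFieldNormedType.Exports.

Local Open Scope classical_set_scope.
Local Open Scope ring_scope.

Section Geodesics.
Context {R : realType}.

(* [d] is a bare function so that the same notion serves in metric spaces and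
   in the model planes below. *)
Definition geodesic (T : Type) (d : T -> T -> R) (A : set T) (x y : T)
    (g : R -> T) : Prop :=
  [/\ g 0 = x, g (d x y) = y,
      forall s, 0 <= s <= d x y -> A (g s) &
      forall s t, 0 <= s <= d x y -> 0 <= t <= d x y -> d (g s) (g t) = `|s - t|].

(* The side [g i] joins the vertex [p i] to the next vertex [p (ordS i)] in
   cyclic order. *)
Definition geodesic_triangle (T : Type) (d : T -> T -> R) (A : set T)
    (p : 'I_3 -> T) (g : 'I_3 -> R -> T) : Prop :=
  forall i, geodesic d A (p i) (p (ordS i)) (g i).

Definition side_length (T : Type) (d : T -> T -> R) (p : 'I_3 -> T) (i : 'I_3) : R :=
  d (p i) (p (ordS i)).

Definition perimeter (T : Type) (d : T -> T -> R) (p : 'I_3 -> T) : R :=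
  \sum_i side_length d p i.

End Geodesics.

Section ModelPlane.
Context {R : realType}.
Implicit Types (k : R) (x y : 'rV[R]_3).

Definition euclid_dot x y : R := \sum_i x 0 i * y 0 i.

Definition lorentz_dot x y : R :=
  x 0 0 * y 0 0 - \sum_(i | i != 0) x 0 i * y 0 i.

Definition arcosh (r : R) : R := ln (r + Num.sqrt (r ^+ 2 - 1)).

(* All three models sit in R^3: the round sphere of radius 1 / sqrt k, the
   coordinate plane x_0 = 0, and the upper sheet of the unit hyperboloid. *)
Definition model_plane k : set 'rV[R]_3 :=
  if 0 < k then [set x | euclid_dot x x = k^-1]
  else if k < 0 then [set x | lorentz_dot x x = 1 /\ 0 < x 0 0]
  else [set x | x 0 0 = 0].

Definition model_dist k x y : R :=
  if 0 < k then acos (k * euclid_dot x y) / Num.sqrt k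
  else if k < 0 then arcosh (lorentz_dot x y) / Num.sqrt (- k)
  else Num.sqrt (euclid_dot (x - y) (x - y)).

Definition model_diam k : \bar R :=
  if 0 < k then (pi / Num.sqrt k)%:E else +oo%E.

End ModelPlane.

Section Curvature.
Context {R : realType} {M : metricType R}.
Implicit Types (k : R) (A : set M) (x : M).

Definition closed_mball x (r : R) : set M := [set y | mdist x y <= r].

(* The subset [A] with the restricted metric is a CAT(k) space. The last clause
   says that the geodesic-preserving map from the comparison triangle
   (p', g') to (p, g) is 1-Lipschitz; this also makes that map well defined.
   Below the perimeter bound, comparison triangles exist and are unique up to
   isometry, so "some" and "every" comparison triangle mean the same. *)
Definition CAT k A : Prop :=
  (forall x y, A x -> A y -> ((mdist x y)%:E < model_diam k)%E ->
     exists g, geodesic mdist A x y g) /\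
  (forall p g, geodesic_triangle mdist A p g ->
     ((perimeter mdist p)%:E < 2%:E * model_diam k)%E ->
     exists p' g',
       [/\ geodesic_triangle (model_dist k) (model_plane k) p' g',
           forall i, side_length (model_dist k) p' i = side_length mdist p i &
           forall i j s t, 0 <= s <= side_length mdist p i ->
             0 <= t <= side_length mdist p j ->
             mdist (g i s) (g j t) <= model_dist k (g' i s) (g' j t)]).

End Curvature.

Definition curvature_bounded_above {R : realType} (M : metricType R) (k : R) : Prop :=
  forall x : M, exists2 U : set M, nbhs x U & CAT k U.

Definition complete_metric {R : realType} (M : metricType R) : Prop :=
  forall F : set_system M, ProperFilter F -> cauchy F -> exists x : M, F --> x.

(* The infimum over the empty space is +oo. The inner supremum would be -oo if
   no ball around [x] were CAT(k), which does not happen when the curvature is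
   bounded above by [k]. *)
Definition cat_radius {R : realType} (M : metricType R) (k : R) : \bar R :=
  ereal_inf [set Order.min
      (ereal_sup [set r%:E | r in [set r : R | 0 < r /\ CAT k (closed_mball x r)]])
      ((2^-1)%:E * model_diam k)%E | x in [set: M]].

Section Jung.
Context {R : realType} (M : metricType R).
Implicit Types A : {fset M}.

Definition fdiam A : R :=
  \big[Num.max/0]_(a <- A) \big[Num.max/0]_(b <- A) mdist a b.

Definition circumradius A : R :=
  inf [set \big[Num.max/0]_(a <- A) mdist x a | x in [set: M]].

(* The ratios are bounded by 1, and [sup set0 = 0]. *)
Definition jung (rho : \bar R) : R :=
  sup [set circumradius A / fdiam A |
       A in [set A : {fset M} | 0 < fdiam A /\ ((fdiam A)%:E < rho)%E]].

(* For [jung rho = 1] the quotient is 0 since [0^-1 = 0]. *)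
Definition jung_slope (rho : \bar R) : R := 2 * jung rho / (1 - jung rho).

End Jung.

Record category := Category {
  obj :> Type;
  mor : obj -> obj -> Type;
  idc : forall a, mor a a;
  compc : forall a b c, mor b c -> mor a b -> mor a c;
  comp_idl : forall a b (f : mor a b), compc (idc b) f = f;
  comp_idr : forall a b (f : mor a b), compc f (idc a) = f;
  comp_assoc : forall a b c d (f : mor c d) (g : mor b c) (h : mor a b),
    compc f (compc g h) = compc (compc f g) h }.
Arguments idc {c0} a : rename.
Arguments compc {c0 a b c} : rename.
Notation "f '\oc' g" := (compc f g) (at level 40, left associativity).

Record functor (C D : category) := Functor {
  fun_obj :> C -> D;
  fun_mor : forall a b, mor a b -> mor (fun_obj a) (fun_obj b);
  fun_mor_id : forall a, fun_mor (idc a) = idc (fun_obj a);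
  fun_mor_comp : forall a b c (f : mor b c) (g : mor a b),
    fun_mor (f \oc g) = fun_mor f \oc fun_mor g }.
Arguments fun_mor {C D} F {a b} : rename.

Section FunctorCategory.
Variables C D : category.

Record nat_trans (F G : functor C D) := NatTrans {
  component :> forall a, mor (F a) (G a);
  naturality : forall a b (f : mor a b),
    component b \oc fun_mor F f = fun_mor G f \oc component a }.

Lemma nat_trans_eq (F G : functor C D) (s t : nat_trans F G) :
  (forall a, s a = t a) -> s = t.
Proof.
case: s t => s sP [t tP] /= st; have {}st : s = t by exact/functional_extensionality_dep.
by rewrite st in sP *; congr NatTrans; exact: Prop_irrelevance.
Qed.

Definition nat_id (F : functor C D) : nat_trans F F.
Proof.
exists (fun a => idc (F a)).
by move=> a b f; rewrite comp_idl comp_idr.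
Defined.

Definition nat_comp (F G H : functor C D) (s : nat_trans G H) (t : nat_trans F G) :
  nat_trans F H.
Proof.
exists (fun a => s a \oc t a).
by move=> a b f; rewrite -comp_assoc naturality comp_assoc naturality comp_assoc.
Defined.

Definition functor_category : category.
Proof.
refine (@Category (functor C D) nat_trans nat_id nat_comp _ _ _).
- by move=> F G s; apply: nat_trans_eq => a; exact: comp_idl.
- by move=> F G s; apply: nat_trans_eq => a; exact: comp_idr.
- by move=> F G H K s t r; apply: nat_trans_eq => a; exact: comp_assoc.
Defined.

End FunctorCategory.

Definition functor_comp (C D E : category) (F : functor D E) (G : functor C D) :
  functor C E.
Proof.
refine (@Functor C E (fun a => F (G a)) (fun a b f => fun_mor F (fun_mor G f)) _ _).
- by move=> a; rewrite !fun_mor_id.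
- by move=> a b c f g; rewrite !fun_mor_comp.
Defined.

Definition precompose (C C' D : category) (S : functor C C') :
  functor (functor_category C' D) (functor_category C D).
Proof.
refine (@Functor (functor_category C' D) (functor_category C D)
  (fun F => functor_comp F S)
  (fun F G s => @NatTrans _ _ (functor_comp F S) (functor_comp G S)
     (fun a => s (S a)) (fun a b f => naturality s (fun_mor S f))) _ _).
- by move=> F; exact: nat_trans_eq.
- by move=> F G H s t; exact: nat_trans_eq.
Defined.

Definition morphism_class (C : category) := forall a b : C, mor a b -> Prop.

(* The localization C[W^-1]: its morphisms are the formal composites of
   morphisms of C and formal inverses of members of W, modulo the congruence
   [word_eq] that makes C -> C[W^-1] a functor and the formal inverses
   inverses. *)
Section Localization.
Variables (C : category) (W : morphism_class C).

Inductive word : C -> C -> Type :=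
| word_hom a b (f : mor a b) : word a b
| word_inv a b (f : mor a b) (Wf : W f) : word b a
| word_comp a b c (v : word b c) (w : word a b) : word a c.

Inductive word_eq : forall a b, word a b -> word a b -> Prop :=
| word_eq_refl a b (w : word a b) : word_eq w w
| word_eq_sym a b (v w : word a b) : word_eq v w -> word_eq w v
| word_eq_trans a b (u v w : word a b) : word_eq u v -> word_eq v w -> word_eq u w
| word_eq_comp a b c (v v' : word b c) (w w' : word a b) :
    word_eq v v' -> word_eq w w' -> word_eq (word_comp v w) (word_comp v' w')
| word_eq_assoc a b c d (u : word c d) (v : word b c) (w : word a b) :
    word_eq (word_comp u (word_comp v w)) (word_comp (word_comp u v) w)
| word_eq_idl a b (w : word a b) : word_eq (word_comp (word_hom (idc b)) w) w
| word_eq_idr a b (w : word a b) : word_eq (word_comp w (word_hom (idc a))) w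
| word_eq_hom a b c (f : mor b c) (g : mor a b) :
    word_eq (word_hom (f \oc g)) (word_comp (word_hom f) (word_hom g))
| word_eq_invl a b (f : mor a b) (Wf : W f) :
    word_eq (word_comp (word_inv Wf) (word_hom f)) (word_hom (idc a))
| word_eq_invr a b (f : mor a b) (Wf : W f) :
    word_eq (word_comp (word_hom f) (word_inv Wf)) (word_hom (idc b)).

Definition loc_hom (a b : C) : Type :=
  {P : word a b -> Prop | exists w, P = word_eq w}.

Definition word_class (a b : C) (w : word a b) : loc_hom a b :=
  exist _ (word_eq w) (ex_intro _ w erefl).

Definition word_repr (a b : C) (f : loc_hom a b) : word a b :=
  projT1 (cid (proj2_sig f)).

Lemma word_reprK (a b : C) (f : loc_hom a b) : word_class (word_repr f) = f.
Proof.
apply: eq_sig_hprop => [P p q|]; first exact: Prop_irrelevance.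
by rewrite /word_repr /=; case: cid => w /= ->.
Qed.

Lemma word_class_eq (a b : C) (v w : word a b) :
  word_class v = word_class w <-> word_eq v w.
Proof.
split=> [/(congr1 (@proj1_sig _ _)) /= ->|vw]; first exact: word_eq_refl.
apply: eq_sig_hprop => [P p q|/=]; first exact: Prop_irrelevance.
apply: functional_extensionality_dep => u; apply: propositional_extensionality.
split=> h; first exact: word_eq_trans (word_eq_sym vw) h.
exact: word_eq_trans vw h.
Qed.

Lemma word_repr_eq (a b : C) (w : word a b) : word_eq (word_repr (word_class w)) w.
Proof. by apply/word_class_eq; rewrite word_reprK. Qed.

Definition loc_comp (a b c : C) (f : loc_hom b c) (g : loc_hom a b) : loc_hom a c :=
  word_class (word_comp (word_repr f) (word_repr g)).

Lemma loc_compE (a b c : C) (v : word b c) (w : word a b) :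
  loc_comp (word_class v) (word_class w) = word_class (word_comp v w).
Proof. by apply/word_class_eq/word_eq_comp; exact: word_repr_eq. Qed.

Definition localization : category.
Proof.
refine (@Category (obj C) loc_hom (fun a => word_class (word_hom (idc a))) loc_comp _ _ _).
- move=> a b f; rewrite -(word_reprK f) loc_compE.
  by apply/word_class_eq; exact: word_eq_idl.
- move=> a b f; rewrite -(word_reprK f) loc_compE.
  by apply/word_class_eq; exact: word_eq_idr.
- move=> a b c d f g h; rewrite -(word_reprK f) -(word_reprK g) -(word_reprK h).
  by rewrite !loc_compE; apply/word_class_eq; exact: word_eq_assoc.
Defined.

Definition loc_functor : functor C localization.
Proof.
refine (@Functor C localization id (fun a b f => word_class (word_hom f)) _ _).
- by [].
- by move=> a b c f g; rewrite /= loc_compE; apply/word_class_eq; exact: word_eq_hom.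
Defined.

End Localization.

Section LocalizedFunctor.
Variables (C D : category) (W : morphism_class C) (W' : morphism_class D).
Variables (F : functor C D) (FW : forall a b (f : mor a b), W f -> W' (fun_mor F f)).

Fixpoint word_map (a b : C) (w : word W a b) : word W' (F a) (F b) :=
  match w with
  | word_hom _ _ f => word_hom W' (fun_mor F f)
  | word_inv _ _ f Wf => word_inv (FW Wf)
  | word_comp _ _ _ v w => word_comp (word_map v) (word_map w)
  end.

Lemma word_map_eq (a b : C) (v w : word W a b) :
  word_eq v w -> word_eq (word_map v) (word_map w).
Proof.
elim=> {a b v w} /=.
- by move=> *; exact: word_eq_refl.
- by move=> *; exact: word_eq_sym.
- by move=> a b u v w _ uv _ vw; exact: word_eq_trans uv vw.
- by move=> *; exact: word_eq_comp.
- by move=> *; exact: word_eq_assoc.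
- by move=> *; rewrite fun_mor_id; exact: word_eq_idl.
- by move=> *; rewrite fun_mor_id; exact: word_eq_idr.
- by move=> *; rewrite fun_mor_comp; exact: word_eq_hom.
- by move=> *; rewrite fun_mor_id; exact: word_eq_invl.
- by move=> *; rewrite fun_mor_id; exact: word_eq_invr.
Qed.

Definition localized_functor : functor (localization W) (localization W').
Proof.
refine (@Functor (localization W) (localization W') (fun_obj F)
  (fun a b f => word_class (word_map (word_repr f))) _ _).
- move=> a; apply/word_class_eq; rewrite -(fun_mor_id F).
  exact: (word_map_eq (word_repr_eq _)).
- move=> a b c f g; rewrite /= loc_compE; apply/word_class_eq.
  exact: (word_map_eq (word_repr_eq _)).
Defined.

End LocalizedFunctor.

Definition Top : category.
Proof.
refine (@Category topologicalType (fun X Y => continuousType X Y)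
  (fun X => [the continuousType X X of idfun])
  (fun X Y Z g f => [the continuousType X Z of g \o f]) _ _ _).
- by move=> X Y f; exact/continuousEP.
- by move=> X Y f; exact/continuousEP.
- by move=> X Y Z T f g h; exact/continuousEP.
Defined.

Section WeakEquivalence.
Variable R : realType.

Definition joined_by_path (X : topologicalType) (x y : X) : Prop :=
  exists g : R -> X,
    [/\ {within `[0, 1], continuous g}, g 0 = x & g 1 = y].

Definition cube n : set 'rV[R]_n := [set t | forall i, 0 <= t 0 i <= 1].
Arguments cube : clear implicits.

Definition cube_boundary n : set 'rV[R]_n :=
  cube n `&` [set t | exists i, t 0 i = 0 \/ t 0 i = 1].
Arguments cube_boundary : clear implicits.

(* Representatives of elements of pi_n(X, x): maps of pairs
   (I^n, boundary of I^n) -> (X, x), of which only the values on I^n matter. *)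
Definition spheroid n (X : topologicalType) (x : X) (a : 'rV[R]_n -> X) : Prop :=
  {within cube n, continuous a} /\ (forall t, cube_boundary n t -> a t = x).

Definition spheroid_homotopic n (X : topologicalType) (x : X)
    (a b : 'rV[R]_n -> X) : Prop :=
  exists h : R * 'rV[R]_n -> X,
    [/\ {within `[0, 1] `*` cube n, continuous h},
        forall t, cube n t -> h (0, t) = a t,
        forall t, cube n t -> h (1, t) = b t &
        forall s t, 0 <= s <= 1 -> cube_boundary n t -> h (s, t) = x].

Definition pi0_bijective (X Y : topologicalType) (f : X -> Y) : Prop :=
  (forall x x', joined_by_path (f x) (f x') -> joined_by_path x x') /\
  (forall y, exists x, joined_by_path (f x) y).

Definition pin_bijective n (X Y : topologicalType) (f : X -> Y) (x : X) : Prop :=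
  (forall a b : 'rV[R]_n -> X, spheroid x a -> spheroid x b ->
     spheroid_homotopic (f x) (f \o a) (f \o b) -> spheroid_homotopic x a b) /\
  (forall c : 'rV[R]_n -> Y, spheroid (f x) c ->
     exists2 a, spheroid x a & spheroid_homotopic (f x) (f \o a) c).

(* The maps induced on homotopy groups are homomorphisms, so bijectivity means
   isomorphism. *)
Definition weak_equivalence (X Y : topologicalType) (f : X -> Y) : Prop :=
  pi0_bijective f /\ (forall n x, (0 < n)%N -> pin_bijective n f x).

End WeakEquivalence.

Section Persistence.
Variables (R : realType) (N : nat).

Definition lev (u v : 'rV[R]_N) : bool := [forall i, u 0 i <= v 0 i].

Lemma lev_refl u : lev u u.
Proof. by apply/forallP => i. Qed.

Lemma lev_trans v u w : lev u v -> lev v w -> lev u w.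
Proof.
move=> /forallP uv /forallP vw; apply/forallP => i.
exact: le_trans (uv i) (vw i).
Qed.

Lemma lev_add2r w u v : lev u v -> lev (u + w) (v + w).
Proof. by move=> /forallP uv; apply/forallP => i; rewrite !mxE lerD2r. Qed.

Lemma lev_addr (e : R) u : 0 <= e -> lev u (u + const_mx e).
Proof. by move=> e0; apply/forallP => i; rewrite !mxE lerDl. Qed.

Definition RN : category.
Proof.
refine (@Category 'rV[R]_N (fun u v => lev u v) lev_refl
  (fun u v w (vw : lev v w) (uv : lev u v) => lev_trans uv vw) _ _ _).
- by move=> *; exact: bool_irrelevance.
- by move=> *; exact: bool_irrelevance.
- by move=> *; exact: bool_irrelevance.
Defined.

Definition persistent_space : category := functor_category RN Top.

Definition objectwise_weak_equivalence : morphism_class persistent_space :=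
  fun F G s => forall u : RN, weak_equivalence R (component s u).

Definition hoTopRN : category := localization objectwise_weak_equivalence.

Definition translation (e : R) : functor RN RN.
Proof.
refine (@Functor RN RN (fun u : 'rV[R]_N => u + const_mx e : 'rV[R]_N)
  (fun u v uv => lev_add2r (const_mx e) uv) _ _).
- by move=> *; exact: bool_irrelevance.
- by move=> *; exact: bool_irrelevance.
Defined.

Definition pshift (e : R) : functor persistent_space persistent_space :=
  precompose Top (translation e).

Lemma pshift_weak_equivalence e (F G : persistent_space) (s : mor F G) :
  objectwise_weak_equivalence s -> objectwise_weak_equivalence (fun_mor (pshift e) s).
Proof. by move=> sW u; exact: sW. Qed.

Definition ho_shift (e : R) : functor hoTopRN hoTopRN :=
  localized_functor (@pshift_weak_equivalence e).

Definition structure_map (e : R) (e0 : 0 <= e) (F : persistent_space) :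
  mor F (pshift e F).
Proof.
exists (fun u => fun_mor F (lev_addr u e0 : @mor RN u (translation e u))).
move=> u v uv; rewrite -!fun_mor_comp.
by congr fun_mor; exact: bool_irrelevance.
Defined.

(* The composites live in mor F (F shifted twice by e): the shift by e + e is
   only propositionally equal to the double shift. *)
Definition interleaved (e : R) (F G : persistent_space) : Prop :=
  exists (e0 : 0 <= e)
         (phi : @mor hoTopRN F (ho_shift e G)) (psi : @mor hoTopRN G (ho_shift e F)),
    let s2 (H : persistent_space) :=
      structure_map e0 (pshift e H) \oc structure_map e0 H in
    fun_mor (ho_shift e) psi \oc phi = fun_mor (loc_functor _) (s2 F) /\
    fun_mor (ho_shift e) phi \oc psi = fun_mor (loc_functor _) (s2 G).

End Persistence.

Record simplicial_complex (V : choiceType) := SimplicialComplex {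
  simplex : set {fset V};
  simplex_neq0 : forall s, simplex s -> s != fset0;
  simplex_face : forall s t : {fset V},
    simplex s -> (t `<=` s)%fset -> t != fset0 -> simplex t }.

Section Realization.
Context {R : realType} {V : choiceType}.
Implicit Types (K L : simplicial_complex V) (s : {fset V}).

(* Barycentric coordinates of points of the closed simplex spanned by [s]. *)
Definition in_closed_simplex s (t : V -> R) : Prop :=
  [/\ forall v, 0 <= t v, forall v, v \notin s -> t v = 0 & \sum_(v <- s) t v = 1].

Record realization K := RealizationPoint {
  bary :> V -> R;
  baryP : exists2 s, simplex K s & in_closed_simplex s bary }.

Lemma realization_eq K (x y : realization K) : bary x =1 bary y -> x = y.
Proof.
case: x y => x xP [y yP] /= /funext xy.
by rewrite xy in xP *; congr RealizationPoint; exact: Prop_irrelevance.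
Qed.

HB.instance Definition _ K := gen_eqMixin (realization K).
HB.instance Definition _ K := gen_choiceMixin (realization K).

(* The weak topology: a set is open iff its trace on every closed simplex is
   open for the Euclidean topology. *)
Definition realization_open K : set_system (realization K) :=
  [set U | forall s, simplex K s -> forall x : realization K, U x -> in_closed_simplex s x ->
     exists2 e : R, 0 < e &
       forall y : realization K, in_closed_simplex s y ->
         (forall v, v \in s -> `|bary x v - bary y v| < e) -> U y].

Lemma realization_openT K : realization_open [set: realization K].
Proof. by move=> s Ks x _ _; exists 1. Qed.

Lemma realization_openI K : setI_closed (@realization_open K).
Proof.
move=> A B oA oB s Ks x [Ax Bx] xs.
have [d d0 dA] := oA s Ks x Ax xs; have [e e0 eB] := oB s Ks x Bx xs.
exists (Num.min d e); first by rewrite lt_min d0.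
move=> y ys xy; split.
- by apply: dA => // v vs; have := xy v vs; rewrite lt_min => /andP[].
- by apply: eB => // v vs; have := xy v vs; rewrite lt_min => /andP[].
Qed.

Lemma realization_open_bigU K (I : Type) (f : I -> set (realization K)) :
  (forall i, realization_open (f i)) -> realization_open (\bigcup_i f i).
Proof.
move=> fo s Ks x [i _ fx] xs; have [e e0 ef] := fo i s Ks x fx xs.
by exists e => // y ys xy; exists i => //; exact: ef.
Qed.

HB.instance Definition _ K := isOpenTopological.Build (realization K)
  (@realization_openT K) (@realization_openI K) (@realization_open_bigU K).

Definition realization_incl K L (KL : simplex K `<=` simplex L) (x : realization K) :
  realization L.
Proof.
exists (bary x).
by have [s Ks xs] := baryP x; exists s => //; exact: KL.
Defined.

Lemma realization_incl_continuous K L (KL : simplex K `<=` simplex L) :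
  continuous (realization_incl KL).
Proof.
apply/continuousP => U oU; suff: realization_open (realization_incl KL @^-1` U) by [].
have {}oU : realization_open U := oU; move=> s Ks x Ux xs.
have [e e0 eU] := oU s (KL _ Ks) _ Ux xs.
by exists e => // y ys xy; exact: eU.
Qed.

End Realization.
Arguments realization R {V} K.
Arguments realization_incl_continuous {R V K L} KL.

Section Rips.
Context {R : realType} {X : metricType R}.

Definition rips_simplex (delta : R) (A : set X) : set {fset X} :=
  [set s : {fset X} | [/\ s != fset0, forall x, x \in s -> A x &
     forall x y, x \in s -> y \in s -> mdist x y < delta]].

Definition rips (delta : R) (A : set X) : simplicial_complex X.
Proof.
exists (rips_simplex delta A); first by move=> s [].
move=> s t [_ sA sd] /fsubsetP ts t0; split=> // [x /ts|x y /ts xs /ts].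
  exact: sA.
exact: sd.
Defined.

Definition sublevel N (g : X -> 'rV[R]_N) (u : 'rV[R]_N) : set X :=
  [set x | lev (g x) u].

Lemma rips_sublevel N (delta : R) (g : X -> 'rV[R]_N) (u v : 'rV[R]_N) : lev u v ->
  simplex (rips delta (sublevel g u)) `<=` simplex (rips delta (sublevel g v)).
Proof.
move=> uv s [s0 su sd]; split=> // x /su gxu.
exact: lev_trans gxu uv.
Qed.

Definition rips_filtration N (delta : R) (g : X -> 'rV[R]_N) : persistent_space R N.
Proof.
refine (@Functor (RN R N) Top
  (fun u => (realization R (rips delta (sublevel g u)) : topologicalType))
  (fun u v uv => [the continuousType _ _ of
     mkcts (realization_incl_continuous (rips_sublevel (delta := delta) (g := g) uv))]) _ _).
- by move=> u; apply/continuousEP => x; exact: realization_eq.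
- by move=> u v w vw uv; apply/continuousEP => x; exact: realization_eq.
Defined.

End Rips.

(* The norm of 'rV[R]_N is the sup-norm. *)
Definition correspondence {R : realType} N (e_met e_fun : R)
    (X0 X1 : metricType R) (f0 : X0 -> 'rV[R]_N) (f1 : X1 -> 'rV[R]_N)
    (C : set (X0 * X1)) : Prop :=
  [/\ forall x, exists y, C (x, y),
      forall y, exists x, C (x, y),
      forall x x' y y', C (x, y) -> C (x', y') ->
        `|mdist x x' - mdist y y'| <= e_met &
      forall x y, C (x, y) -> `|f0 x - f1 y| <= e_fun].

(* Main.v *)
Require Import Defs.
From HB Require Import structures.
From mathcomp Require Import all_boot all_order all_algebra finmap.
From mathcomp Require Import all_classical all_reals all_analysis.
From mathcomp Require Import ring lra.

Set Implicit Arguments.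
Unset Strict Implicit.
Unset Printing Implicit Defensive.

Import Order.TTheory GRing.Theory Num.Theory.
Import numFieldNormedType.Exports.

Local Open Scope classical_set_scope.
Local Open Scope ring_scope.

(* Write J for the Jung constant, e for [e_met], and r = 2 J e / (1 - J). A finite set s
   in M of diameter D < delta + e has an approximate circumcentre z at distance about
   J D from s, and z can be taken in the hull of s, the closure of s under midpoints.
   Moving a vertex of s towards z by at most r gives a point p s of the hull. By
   convexity of the distance, p s is at distance less than delta - e from all of s:
   moving by r lowers the bound D by r (1 - J) / J = 2 e. Balls contain the hulls of
   their subsets, so p t and p s are also closer than delta - e when t is a subset of s.

   A correspondence gives maps c' : MM -> M and c : M -> MM. Sending a flag of simplices
   to the images of its members under s |-> p (c' s) and under s |-> c (p s) defines
   strict natural transformations of realizations. Their composites are homotopic to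
   the structure maps: writing a point of a realization as the integral of its
   superlevel sets, one moves the part below level l onto the images of these sets and
   leaves the part above it in place, and l runs from 0 to 1. A natural homotopy gives
   an equality in the localization because the projection of the cylinder F x R to F
   is an objectwise weak equivalence. *)

(** The scales [delta + e] and [delta - e] come from the distortion: [c'] turns a simplex of
    diameter below [delta] into a set of diameter below [delta + e], and a set of M must have
    diameter below [delta - e] before [c] can be trusted to make it a simplex. The second bound on e
    amounts to J (delta + e) <= delta - e, so an approximate circumcentre is itself close enough to
    s; stopping on the way to it keeps the displacement, hence the change of level under f, linear
    in e.

    The obstacle on the homotopy side is that p depends on a simplex and not on its vertices, so it
    gives no simplicial map, while morphisms of persistent spaces must commute strictly with
    inclusions. Superlevel sets give a formula on points of the realization that does not depend on
    the simplex chosen to contain the point, and strict naturality follows. A composite of two such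
    maps involves flags of flags. It is brought back to the same form by factoring through the Rips
    complex of M at scale [delta - e], where [c] is simplicial; this is why each composite needs two
    homotopies. *)

Section BigMinMax.
Context {R : realType} {I : eqType}.
Implicit Types (r : seq I) (f : I -> R) (a c : R).

Lemma bigmax_seq_leE r f a c :
  (\big[Num.max/a]_(i <- r) f i <= c) = (a <= c) && all (fun i => f i <= c) r.
Proof.
by elim: r => [|i r IH]; rewrite ?big_nil ?andbT // big_cons ge_max IH andbCA.
Qed.

Lemma bigmax_seq_ltE r f a c :
  (\big[Num.max/a]_(i <- r) f i < c) = (a < c) && all (fun i => f i < c) r.
Proof.
by elim: r => [|i r IH]; rewrite ?big_nil ?andbT // big_cons gt_max IH andbCA.
Qed.

Lemma bigmin_seq_ltE r f a c :
  (c < \big[Num.min/a]_(i <- r) f i) = (c < a) && all (fun i => c < f i) r.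
Proof.
by elim: r => [|i r IH]; rewrite ?big_nil ?andbT // big_cons lt_min IH andbCA.
Qed.

End BigMinMax.

(** * Trigonometry of the model planes *)

Section ModelFunctions.
Context {R : realType}.
Variable k : R.

(** [cs] and [sn] are the solutions of y'' = - k y with initial data (1, 0) and (0, 1), the
    generalized cosine and sine. *)
Definition cs (x : R) : R :=
  if 0 < k then cos (Num.sqrt k * x)
  else if k < 0 then
    (expR (Num.sqrt (- k) * x) + expR (- (Num.sqrt (- k) * x))) / 2
  else 1.

Definition sn (x : R) : R :=
  if 0 < k then sin (Num.sqrt k * x) / Num.sqrt k
  else if k < 0 then
    (expR (Num.sqrt (- k) * x) - expR (- (Num.sqrt (- k) * x))) / 2 / Num.sqrt (- k)
  else x.

(* The constant term removed and divided by [k], [cs] becomes a modified distance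
   that degenerates to [x ^+ 2 / 2] for k = 0; in the model planes it is half of a
   quadratic form evaluated at the difference of two points. *)
Definition md (x : R) : R := if k == 0 then x ^+ 2 / 2 else (1 - cs x) / k.

(** One case analysis settles every sign test on [k] and supplies the root [r], after which the
    identities are rational in [r]. *)
Variant curv_spec : bool -> bool -> bool -> Type :=
| CurvPos r of 0 < r & k = r ^+ 2 & Num.sqrt k = r : curv_spec true false false
| CurvNeg r of 0 < r & k = - r ^+ 2 & Num.sqrt (- k) = r : curv_spec false true false
| CurvZero of k = 0 : curv_spec false false true.

Lemma curvP : curv_spec (0 < k) (k < 0) (k == 0).
Proof.
case: (ltgtP k 0) => [k0|k0|k0]; last exact: CurvZero.
- have k0' : 0 < - k by rewrite oppr_gt0.
  by apply: (@CurvNeg (Num.sqrt (- k))); rewrite ?sqrtr_gt0 ?sqr_sqrtr ?opprK ?ltW.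
- by apply: (@CurvPos (Num.sqrt k)); rewrite ?sqrtr_gt0 ?sqr_sqrtr ?ltW.
Qed.

Lemma cs_md x : cs x = 1 - k * md x.
Proof.
rewrite /md /cs; case: curvP => [r r0 kE rE|r r0 kE rE|k0].
- by field; rewrite kE sqrf_eq0 gt_eqF.
- by field; rewrite kE oppr_eq0 sqrf_eq0 gt_eqF.
- by rewrite k0 mul0r subr0.
Qed.

Lemma md0 : md 0 = 0.
Proof.
rewrite /md /cs; case: curvP => [r r0 kE rE|r r0 kE rE|k0].
- by rewrite mulr0 cos0 subrr mul0r.
- by rewrite mulr0 oppr0 expR0; field; rewrite kE oppr_eq0 sqrf_eq0 gt_eqF.
- by rewrite expr0n mul0r.
Qed.

Lemma sn0 : sn 0 = 0.
Proof.
rewrite /sn; case: curvP => [r r0 kE rE|r r0 kE rE|k0] //.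
- by rewrite mulr0 sin0 mul0r.
- by rewrite mulr0 oppr0 expR0 subrr !mul0r.
Qed.

Lemma md_opp x : md (- x) = md x.
Proof.
rewrite /md /cs; case: curvP => [r r0 kE rE|r r0 kE rE|k0].
- by rewrite mulrN cosN.
- by rewrite mulrN opprK [_ + expR (_ * x)]addrC.
- by rewrite sqrrN.
Qed.

Lemma md_norm x : md `|x| = md x.
Proof. by case: (ger0P x) => // _; exact: md_opp. Qed.

(** The form of cs ^ 2 + k sn ^ 2 = 1 that keeps its content at k = 0. *)
Lemma sqr_sn x : sn x ^+ 2 = md x * (1 + cs x).
Proof.
rewrite /sn /md /cs; case: curvP => [r r0 kE rE|r r0 kE rE|k0].
- rewrite rE expr_div_n sin2cos2 kE; field; exact: lt0r_neq0.
- rewrite rE kE expRN.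
  have e0 : expR (r * x) != 0 by exact: lt0r_neq0 (expR_gt0 _).
  by field; rewrite e0 lt0r_neq0.
- by field.
Qed.

Lemma snB x y : sn (x - y) = sn x * cs y - cs x * sn y.
Proof.
rewrite /sn /cs; case: curvP => [r r0 kE rE|r r0 kE rE|k0].
- rewrite rE mulrBr sinB; field; exact: lt0r_neq0.
- rewrite rE mulrBr opprB !expRD !expRN.
  have e0 : expR (r * x) != 0 by exact: lt0r_neq0 (expR_gt0 _).
  have e1 : expR (r * y) != 0 by exact: lt0r_neq0 (expR_gt0 _).
  by field; rewrite e0 e1 lt0r_neq0.
- by ring.
Qed.

(** The sum-to-product formula for the cosine, with the division by [k] carried out; at k = 0 it is
    the parallelogram law on the line. *)
Lemma mdDB x y : md (x + y) + md (x - y) = 2 * md x * cs y + 2 * md y.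
Proof.
rewrite /md /cs; case: curvP => [r r0 kE rE|r r0 kE rE|k0].
- rewrite rE mulrDr mulrBr cosB cosD kE; field; exact: lt0r_neq0.
- rewrite rE mulrBr mulrDr opprB opprD !expRD !expRN kE.
  have e0 : expR (r * x) != 0 by exact: lt0r_neq0 (expR_gt0 _).
  have e1 : expR (r * y) != 0 by exact: lt0r_neq0 (expR_gt0 _).
  by field; rewrite e0 e1 lt0r_neq0.
- by field.
Qed.

Lemma md_half x : md x = 2 * md (x / 2) * (1 + cs (x / 2)).
Proof.
have := mdDB (x / 2) (x / 2).
by rewrite subrr md0 addr0 -splitr => ->; ring.
Qed.

Lemma cs_half x : cs x = 1 - 2 * k * md (x / 2) * (1 + cs (x / 2)).
Proof. by rewrite cs_md md_half; ring. Qed.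

Lemma sn_half x : sn x = 2 * sn (x / 2) * cs (x / 2).
Proof.
have snN y : sn (- y) = - sn y.
  rewrite -[- y]add0r snB sn0 mul0r add0r.
  by rewrite cs_md md0 mulr0 subr0 mul1r.
have csN y : cs (- y) = cs y by rewrite !cs_md md_opp.
have {1}-> : x = x / 2 - - (x / 2) by lra.
by rewrite snB csN snN; ring.
Qed.

Lemma continuous_sn : continuous sn.
Proof.
rewrite /sn; case: curvP => [r r0 kE rE|r r0 kE rE|k0] x; last exact: cvg_id.
- apply: cvgMl; apply: (@continuous_comp _ _ _ ( *%R (Num.sqrt k)) sin).
    exact: mulrl_continuous.
  exact: continuous_sin.
- do 2 apply: cvgMl; apply: cvgB.
    apply: (@continuous_comp _ _ _ ( *%R (Num.sqrt (- k))) expR).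
      exact: mulrl_continuous.
    exact: continuous_expR.
  apply: (@continuous_comp _ _ _ (fun x => - (Num.sqrt (- k) * x)) expR).
    by apply: continuousN; exact: mulrl_continuous.
  exact: continuous_expR.
Qed.

Lemma md_lt x y : (0 < k -> Num.sqrt k * y <= pi) -> 0 <= x -> x < y -> md x < md y.
Proof.
rewrite /md /cs; case: curvP => [r r0 kE rE|r r0 kE rE|k0].
- move=> /(_ isT); rewrite rE kE => ypi x0 xy.
  rewrite ltr_pM2r ?invr_gt0 ?exprn_gt0// ltrD2l ltrN2.
  have rxy : r * x < r * y by rewrite ltr_pM2l.
  have rx0 : 0 <= r * x by rewrite mulr_ge0 // ltW.
  rewrite ltr_cos // in_itv /=; [by rewrite rx0 (le_trans (ltW rxy) ypi)|by rewrite (le_trans rx0 (ltW rxy)) ypi].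
- rewrite rE kE => _ x0 xy.
  rewrite -subr_gt0 !expRN.
  have a1 : 1 <= expR (r * x) by rewrite -expR0 ler_expR mulr_ge0 // ltW.
  have ab : expR (r * x) < expR (r * y) by rewrite ltr_expR ltr_pM2l.
  move: a1 ab; set a := expR _; set b := expR _ => a1 ab.
  have a0 : 0 < a by exact: lt_le_trans a1.
  have b0 : 0 < b by exact: lt_trans ab.
  rewrite (_ : _ - _ = (b - a) * (a * b - 1) / (2 * r ^+ 2 * a * b)).
    apply: divr_gt0; last by rewrite !mulr_gt0 ?exprn_gt0.
    by rewrite mulr_gt0 ?subr_gt0 //; nra.
  by field; rewrite !lt0r_neq0.
- move=> _ x0 xy; rewrite ltr_pM2r ?invr_gt0 // ltr_sqr ?nnegrE //.
  exact: le_trans (ltW xy).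
Qed.

Lemma md_le x y : (0 < k -> Num.sqrt k * y <= pi) -> 0 <= x -> x <= y -> md x <= md y.
Proof.
move=> ypi x0; rewrite le_eqVlt => /predU1P[->//|xy].
exact/ltW/md_lt.
Qed.

Lemma cs_gt0 x : (0 < k -> Num.sqrt k * x < pi / 2) -> 0 <= x -> 0 < cs x.
Proof.
rewrite /cs; case: curvP => [r r0 kE rE|r r0 kE rE|k0].
- move=> /(_ isT) xpi x0; apply: cos_gt0_pihalf; rewrite xpi andbT rE.
  apply: (@lt_le_trans _ _ 0); first by rewrite oppr_lt0 divr_gt0 ?pi_gt0.
  by rewrite mulr_ge0 // ltW.
- by move=> _ _; rewrite divr_gt0 // addr_gt0 // expR_gt0.
- by move=> _ _; exact: ltr01.
Qed.

Lemma sn_gt0 x : (0 < k -> Num.sqrt k * x < pi) -> 0 < x -> 0 < sn x.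
Proof.
rewrite /sn; case: curvP => [r r0 kE rE|r r0 kE rE|k0] //.
- move=> /(_ isT) xpi x0; rewrite divr_gt0 ?rE // sin_gt0_pi //.
  by rewrite mulr_gt0 //= -rE.
- move=> _ x0; rewrite !divr_gt0 ?rE// subr_gt0 ltr_expR.
  by have := mulr_gt0 r0 x0; lra.
Qed.

Lemma md_ge0 x : (0 < k -> Num.sqrt k * x <= pi) -> 0 <= x -> 0 <= md x.
Proof. by move=> xpi x0; rewrite -md0 md_le. Qed.

Lemma cs_bound x y : (0 < k -> Num.sqrt k * y <= pi) -> 0 <= x -> x <= y ->
  cs x <= 1 + `|k| * md y.
Proof.
move=> ypi x0 xy; rewrite cs_md lerD2l -mulNr.
have mx := md_ge0 (fun k0 => le_trans (ler_wpM2l (sqrtr_ge0 k) xy) (ypi k0)) x0.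
apply: (le_trans (ler_norm _)); rewrite normrM normrN (ger0_norm mx).
by rewrite ler_wpM2l // md_le.
Qed.

End ModelFunctions.

Section ModelPlanes.
Context {R : realType}.
Implicit Types (k c t : R) (x y q m : 'rV[R]_3).

Let i1 : 'I_3 := lift ord0 ord0.
Let i2 : 'I_3 := lift ord0 (lift ord0 ord0).

Lemma euclid_dot3 x y :
  euclid_dot x y = x 0 0 * y 0 0 + x 0 i1 * y 0 i1 + x 0 i2 * y 0 i2.
Proof. by rewrite /euclid_dot !big_ord_recl big_ord0 addr0 addrA. Qed.

Lemma lorentz_dot3 x y :
  lorentz_dot x y = x 0 0 * y 0 0 - (x 0 i1 * y 0 i1 + x 0 i2 * y 0 i2).
Proof.
by rewrite /lorentz_dot big_mkcond !big_ord_recl big_ord0 /= add0r addr0.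
Qed.

Lemma row3P x y : x 0 0 = y 0 0 -> x 0 i1 = y 0 i1 -> x 0 i2 = y 0 i2 -> x = y.
Proof.
move=> e0 e1 e2; apply/rowP => i.
case: (unliftP ord0 i) => [j|] ->; last exact: e0.
case: (unliftP ord0 j) => [l|] ->; last exact: e1.
by rewrite ord1.
Qed.

Lemma sum3sq_eq0 (a b d : R) : a * a + b * b + d * d = 0 -> [/\ a = 0, b = 0 & d = 0].
Proof.
move/eqP; rewrite -!expr2 !paddr_eq0 ?addr_ge0 ?sqr_ge0 // !sqrf_eq0.
by move=> /andP[/andP[/eqP-> /eqP->] /eqP->].
Qed.

Lemma euclid_dot_ge0 x : 0 <= euclid_dot x x.
Proof. by rewrite euclid_dot3 -!expr2 !addr_ge0 ?sqr_ge0. Qed.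

(** Expanding the square of w = x + y - 2 t m gives 0, so w vanishes: the midpoint is a multiple of
    x + y. Pairing w with [q] is the claim. *)
Lemma sphere_midpoint k x y q m t : 0 < k ->
  euclid_dot x x = k^-1 -> euclid_dot y y = k^-1 -> euclid_dot m m = k^-1 ->
  k * euclid_dot x m = t -> k * euclid_dot m y = t ->
  k * euclid_dot x y = 2 * t ^+ 2 - 1 ->
  2 * t * (k * euclid_dot q m) = k * euclid_dot q x + k * euclid_dot q y.
Proof.
move=> k0 xx yy mm xm my xy.
pose w := x + y - (2 * t) *: m.
have ww : euclid_dot w w = 0.
  apply: (mulfI (lt0r_neq0 k0)); rewrite mulr0.
  transitivity (k * euclid_dot x x + k * euclid_dot y y + 4 * t ^+ 2 * (k * euclid_dot m m)
    + 2 * (k * euclid_dot x y) - 4 * t * (k * euclid_dot x m) - 4 * t * (k * euclid_dot m y)).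
    by rewrite !euclid_dot3 /w !mxE; ring.
  rewrite xx yy mm xm my xy mulfV ?lt0r_neq0 //; ring.
have qw : euclid_dot q w = 0.
  move: ww; rewrite !euclid_dot3; set a := w 0 0; set b := w 0 i1; set d := w 0 i2.
  by move/sum3sq_eq0 => [-> -> ->]; rewrite !mulr0 !addr0.
have : k * euclid_dot q w = 0 by rewrite qw mulr0.
rewrite !euclid_dot3 /w !mxE; lra.
Qed.

Lemma lorentz_ge1 x y : lorentz_dot x x = 1 -> 0 < x 0 0 ->
  lorentz_dot y y = 1 -> 0 < y 0 0 -> 1 <= lorentz_dot x y.
Proof.
rewrite !lorentz_dot3; set a := x 0 0; set b := x 0 i1; set c := x 0 i2.
set a' := y 0 0; set b' := y 0 i1; set c' := y 0 i2 => e a0 e' a0'.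
rewrite lerBrDl; set s := b * b' + c * c'.
have [s0|s0] := lerP (s + 1) 0; first by apply: (le_trans s0); rewrite mulr_ge0 // ltW.
rewrite -ler_sqr ?nnegrE ?mulr_ge0 ?(ltW s0) ?(ltW a0) ?(ltW a0') //.
have aE : a ^+ 2 = 1 + b ^+ 2 + c ^+ 2 by rewrite !expr2; lra.
have aE' : a' ^+ 2 = 1 + b' ^+ 2 + c' ^+ 2 by rewrite !expr2; lra.
rewrite exprMn aE aE' /s -subr_ge0.
(* Lagrange's identity for the vectors (1, b, c) and (1, b', c'). *)
rewrite (_ : _ - _ = (b * c' - c * b') ^+ 2 + (b - b') ^+ 2 + (c - c') ^+ 2); last by ring.
by rewrite !addr_ge0 ?sqr_ge0.
Qed.

(* The orthogonal complement of a timelike vector contains no nonzero lightlike vector. *)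
Lemma hyperboloid_midpoint x y q m t :
  lorentz_dot x x = 1 -> lorentz_dot y y = 1 -> lorentz_dot m m = 1 ->
  lorentz_dot x m = t -> lorentz_dot m y = t ->
  lorentz_dot x y = 2 * t ^+ 2 - 1 ->
  2 * t * lorentz_dot q m = lorentz_dot q x + lorentz_dot q y.
Proof.
move=> xx yy mm xm my xy.
pose w := x + y - (2 * t) *: m.
have ww : lorentz_dot w w = 0.
  transitivity (lorentz_dot x x + lorentz_dot y y + 4 * t ^+ 2 * lorentz_dot m m
    + 2 * lorentz_dot x y - 4 * t * lorentz_dot x m - 4 * t * lorentz_dot m y).
    by rewrite !lorentz_dot3 /w !mxE; ring.
  rewrite xx yy mm xm my xy; ring.
have wm : lorentz_dot w m = 0.
  transitivity (lorentz_dot x m + lorentz_dot m y - 2 * t * lorentz_dot m m).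
    by rewrite !lorentz_dot3 /w !mxE; ring.
  rewrite xm my mm; ring.
have qw : lorentz_dot q w = 0.
  move: ww wm mm; rewrite !lorentz_dot3.
  set a := w 0 0; set b := w 0 i1; set d := w 0 i2.
  set a' := m 0 0; set b' := m 0 i1; set d' := m 0 i2 => ww wm mm.
  have aa : a * a = b * b + d * d by lra.
  have am : a * a' = b * b' + d * d' by lra.
  have mE : a' * a' = 1 + b' * b' + d' * d' by lra.
  have a0 : a = 0.
    have : (a * a') ^+ 2 + (b * d' - d * b') ^+ 2 = (a * a) * (a' * a' - 1).
      by rewrite am aa mE; ring.
    rewrite exprMn mulrBr mulr1 -!expr2 => aX.
    have : a ^+ 2 + (b * d' - d * b') ^+ 2 = 0 by lra.
    by move/eqP; rewrite paddr_eq0 ?sqr_ge0 // sqrf_eq0 => /andP[/eqP].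
  have [_ b0 d0] : [/\ 0 = 0 :> R, b = 0 & d = 0] by apply: sum3sq_eq0; move: aa; rewrite a0; lra.
  by rewrite a0 b0 d0 !mulr0 !addr0 subr0.
move: qw; rewrite !lorentz_dot3 /w !mxE; lra.
Qed.

Lemma plane_midpoint x y q m t : euclid_dot (x - m) (x - m) = t ^+ 2 ->
  euclid_dot (m - y) (m - y) = t ^+ 2 -> euclid_dot (x - y) (x - y) = (2 * t) ^+ 2 ->
  euclid_dot (q - m) (q - m) =
    (euclid_dot (q - x) (q - x) + euclid_dot (q - y) (q - y)) / 2 - t ^+ 2.
Proof.
move=> xm my xy.
pose w := x + y - 2 *: m.
have ww : euclid_dot w w = 0.
  transitivity (2 * euclid_dot (x - m) (x - m) + 2 * euclid_dot (m - y) (m - y)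
    - euclid_dot (x - y) (x - y)); last by rewrite xm my xy; ring.
  by rewrite !euclid_dot3 /w !mxE; ring.
have [a0 b0 d0] : [/\ w 0 0 = 0, w 0 i1 = 0 & w 0 i2 = 0].
  by apply: sum3sq_eq0; rewrite -euclid_dot3.
have mE : m = 2^-1 *: (x + y).
  apply: row3P; rewrite !mxE; move: a0 b0 d0; rewrite /w !mxE; lra.
rewrite -xm mE !euclid_dot3 !mxE.
move: xy; rewrite -[(2 * t) ^+ 2](_ : 4 * t ^+ 2 = _); last by ring.
rewrite -xm mE !euclid_dot3 !mxE; lra.
Qed.

Lemma sphere_dot_bound k x y : 0 < k -> euclid_dot x x = k^-1 -> euclid_dot y y = k^-1 ->
  -1 <= k * euclid_dot x y <= 1.
Proof.
move=> k0 xx yy.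
have kk : k * k^-1 = 1 by rewrite mulfV ?lt0r_neq0.
have e1 : 0 <= k * euclid_dot (x - y) (x - y).
  by rewrite mulr_ge0 ?(ltW k0) ?euclid_dot_ge0.
have e2 : 0 <= k * euclid_dot (x + y) (x + y).
  by rewrite mulr_ge0 ?(ltW k0) ?euclid_dot_ge0.
have e3 : k * euclid_dot (x - y) (x - y) =
    k * euclid_dot x x + k * euclid_dot y y - 2 * (k * euclid_dot x y).
  by rewrite !euclid_dot3 !mxE; ring.
have e4 : k * euclid_dot (x + y) (x + y) =
    k * euclid_dot x x + k * euclid_dot y y + 2 * (k * euclid_dot x y).
  by rewrite !euclid_dot3 !mxE; ring.
by move: e1 e2; rewrite e3 e4 xx yy kk => e1 e2; apply/andP; split; lra.
Qed.

Lemma cosh_arcosh (r : R) : 1 <= r -> (expR (arcosh r) + expR (- arcosh r)) / 2 = r.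
Proof.
move=> r1; have s0 : 0 <= r ^+ 2 - 1 by nra.
rewrite /arcosh; set s := Num.sqrt _.
have sE : s ^+ 2 = r ^+ 2 - 1 by rewrite sqr_sqrtr.
have s_ge0 : 0 <= s by exact: sqrtr_ge0.
have rs : 0 < r + s by lra.
rewrite expRN lnK ?posrE //.
have -> : (r + s)^-1 = r - s.
  by apply: (mulfI (lt0r_neq0 rs)); rewrite mulfV ?lt0r_neq0 //; move: sE; rewrite !expr2; lra.
by field.
Qed.

Lemma arcosh_ge0 (r : R) : 1 <= r -> 0 <= arcosh r.
Proof. by move=> r1; apply: ln_ge0; have := sqrtr_ge0 (r ^+ 2 - 1); lra. Qed.

Lemma model_dist_range k x y : model_plane k x -> model_plane k y ->
  0 <= model_dist k x y /\ (0 < k -> Num.sqrt k * model_dist k x y <= pi).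
Proof.
rewrite /model_plane /model_dist; case: curvP => [r r0 kE rE|r r0 kE rE|k0] /=.
- move=> xx yy; have k0 : 0 < k by rewrite kE exprn_gt0.
  have b := sphere_dot_bound k0 xx yy.
  rewrite rE; split=> [|_]; first by rewrite divr_ge0 ?acos_ge0 // ltW.
  by rewrite mulrC divfK ?lt0r_neq0 // acos_lepi.
- move=> [xx x0] [yy y0]; split=> //.
  by rewrite rE divr_ge0 ?arcosh_ge0 ?(ltW r0) // lorentz_ge1.
- by move=> _ _; split=> //; exact: sqrtr_ge0.
Qed.

Lemma model_midpoint k x y q m c :
  model_plane k x -> model_plane k y -> model_plane k q -> model_plane k m ->
  model_dist k x m = c / 2 -> model_dist k m y = c / 2 -> model_dist k x y = c ->
  md k (model_dist k q m) * cs k (c / 2) =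
    (md k (model_dist k q x) + md k (model_dist k q y)) / 2 - md k (c / 2).
Proof.
move=> Px Py Pq Pm xm my xy.
have [k0|k0] := eqVneq k 0.
  move: xm my xy; rewrite cs_md /md /model_dist k0 !ltxx eqxx mul0r subr0 mulr1 => xm my xy.
  have E (z : 'rV[R]_3) d : Num.sqrt (euclid_dot z z) = d -> euclid_dot z z = d ^+ 2.
    by move=> <-; rewrite sqr_sqrtr // euclid_dot_ge0.
  rewrite !sqr_sqrtr ?euclid_dot_ge0 // (@plane_midpoint x y q m (c / 2)); [lra|exact: E..|].
  by rewrite (E _ c) //; field.
(* For k != 0 the law is the relation x + y = 2 t m paired with [q], where t = cs (c / 2); [md] only
   rescales it. *)
suff : 2 * cs k (c / 2) * cs k (model_dist k q m) =
    cs k (model_dist k q x) + cs k (model_dist k q y).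
  rewrite !(cs_md k) => e; apply: (mulfI k0); move: e.
  set a := md k _; set b := md k _; set d := md k _; set g := md k _ => e.
  transitivity ((2 * (1 - k * a) - 2 * (1 - k * a) * (1 - k * b)) / 2); first by field.
  by rewrite e; field.
have cc : cs k c = 2 * cs k (c / 2) ^+ 2 - 1.
  by rewrite cs_half (cs_md k (c / 2)); ring.
move: cc Px Py Pq Pm; rewrite -{1}xy.
have cxm : cs k (c / 2) = cs k (model_dist k x m) by rewrite xm.
have cmy : cs k (c / 2) = cs k (model_dist k m y) by rewrite my.
move: cxm cmy; move: (cs k (c / 2)) => t.
rewrite /cs /model_plane /model_dist.
case: curvP => [r r0 kE rE|r r0 kE rE|/eqP]; last by rewrite (negPf k0).
- have kp : 0 < k by rewrite kE exprn_gt0.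
  have B u v : euclid_dot u u = k^-1 -> euclid_dot v v = k^-1 ->
      cos (Num.sqrt k * (acos (k * euclid_dot u v) / Num.sqrt k)) = k * euclid_dot u v.
    move=> uu vv; rewrite rE mulrC (divfK (lt0r_neq0 r0)).
    by apply: acosK; rewrite in_itv /=; exact: sphere_dot_bound.
  move=> cxm cmy cxy xx yy qq mm.
  refine (etrans (congr1 (fun z => 2 * t * z) (B _ _ qq mm)) (etrans _
    (esym (congr2 +%R (B _ _ qq xx) (B _ _ qq yy))))).
  apply: (sphere_midpoint q kp xx yy mm).
  - exact: etrans (esym (B _ _ xx mm)) (esym cxm).
  - exact: etrans (esym (B _ _ mm yy)) (esym cmy).
  - exact: etrans (esym (B _ _ xx yy)) cxy.
- have B u v : lorentz_dot u u = 1 /\ 0 < u 0 0 -> lorentz_dot v v = 1 /\ 0 < v 0 0 ->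
      (expR (Num.sqrt (- k) * (arcosh (lorentz_dot u v) / Num.sqrt (- k))) +
       expR (- (Num.sqrt (- k) * (arcosh (lorentz_dot u v) / Num.sqrt (- k))))) / 2 =
      lorentz_dot u v.
    move=> [uu u0] [vv v0]; rewrite rE [r * _]mulrC (divfK (lt0r_neq0 r0)).
    by apply: cosh_arcosh; exact: lorentz_ge1.
  move=> cxm cmy cxy xx yy qq mm.
  refine (etrans (congr1 (fun z => 2 * t * z) (B _ _ qq mm)) (etrans _
    (esym (congr2 +%R (B _ _ qq xx) (B _ _ qq yy))))).
  apply: (hyperboloid_midpoint q xx.1 yy.1 mm.1).
  - exact: etrans (esym (B _ _ xx mm)) (esym cxm).
  - exact: etrans (esym (B _ _ mm yy)) (esym cmy).
  - exact: etrans (esym (B _ _ xx yy)) cxy.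
Qed.

End ModelPlanes.

(** * Midpoints in CAT(k) balls *)

Section MidpointLaw.
Context {R : realType} {M : metricType R}.
Variables (k rho : R).
Hypothesis rho_le : (rho%:E <= cat_radius M k)%E.
Implicit Types x y q m : M.
Local Notation d := (@mdist _ M).

(** The identity of [model_midpoint], weakened to the inequality that comparison yields. The point
    [q] is only required to be near [x], the centre of the CAT(k) ball in which the triangle is
    compared. *)
Definition midpoint_law x y m : Prop :=
  [/\ d x m = d x y / 2, d y m = d x y / 2 &
      forall q, d x q < rho ->
        md k (d q m) * cs k (d x y / 2) <=
          (md k (d q x) + md k (d q y)) / 2 - md k (d x y / 2)].

(** The point [x] matters: over an empty space the infimum [cat_radius] would be +oo. *)
Lemma rho_le_pi x : 0 < k -> Num.sqrt k * rho <= pi / 2.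
Proof.
move=> k0.
have /(le_trans rho_le) : (cat_radius M k <= (2^-1)%:E * model_diam k)%E.
  apply: ge_ereal_inf; exists (Order.min
      (ereal_sup [set r%:E | r in [set r : R | 0 < r /\ CAT k (closed_mball x r)]])
      ((2^-1)%:E * model_diam k)%E); first by exists x.
  by rewrite ge_min lexx orbT.
rewrite /model_diam k0 -EFinM lee_fin => h.
have s0 : 0 < Num.sqrt k by rewrite sqrtr_gt0.
by rewrite -ler_pdivlMl // (le_trans h) // mulrA [leRHS]mulrC [2^-1 * pi]mulrC.
Qed.

Lemma cat_ball x r : r < rho -> exists2 r', r < r' & CAT k (closed_mball x r').
Proof.
move=> rrho.
pose S := [set r : R | 0 < r /\ CAT k (closed_mball x r)].
have : (r%:E < ereal_sup [set r%:E | r in S])%E.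
  apply: lt_le_trans (_ : rho%:E <= _)%E; first by rewrite lte_fin.
  apply: (le_trans rho_le); apply: ge_ereal_inf.
  exists (Order.min
      (ereal_sup [set r%:E | r in [set r : R | 0 < r /\ CAT k (closed_mball x r)]])
      ((2^-1)%:E * model_diam k)%E); first by exists x.
  by rewrite ge_min lexx.
move/ereal_sup_gt => [_ [r' [_ cr'] <-]]; rewrite lte_fin => rr'.
by exists r'.
Qed.

Lemma geodesic_in_ball x y r g : geodesic d [set: M] x y g -> d x y <= r ->
  geodesic d (closed_mball x r) x y g.
Proof.
move=> [g0 g1 _ gd] xyr; split=> // s sxy.
rewrite /closed_mball /= -g0 gd ?lexx ?mdist_ge0 //.
by move: sxy => /andP[s0 sxy]; rewrite sub0r normrN ger0_norm // (le_trans sxy).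
Qed.

(* The comparison triangle is taken in a CAT ball around [x]: it contains every
   geodesic issuing from [x], so the midpoint can be chosen before [q]. *)
Lemma midpoint_exists x y : d x y < rho -> exists m, midpoint_law x y m.
Proof.
move=> xy.
have lt_diam u : u < 2 * rho -> (u%:E < model_diam k)%E.
  move=> u2; rewrite /model_diam; case: ifPn => [k0|_]; last exact: ltry.
  have s0 : 0 < Num.sqrt k by rewrite sqrtr_gt0.
  rewrite lte_fin ltr_pdivlMr // (lt_le_trans (_ : _ < 2 * rho * Num.sqrt k)) ?ltr_pM2r //.
  by have := rho_le_pi x k0; lra.
have rho0 : 0 < rho by exact: le_lt_trans (mdist_ge0 _ _) xy.
have [r1 xyr1 [cat1 _]] := cat_ball x xy.
have [g gg] : exists g, geodesic d (closed_mball x r1) x y g.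
  apply: cat1; first by rewrite /closed_mball /= mdistxx (le_trans (mdist_ge0 x y)) // ltW.
    by rewrite /closed_mball /= ltW.
  by apply: lt_diam; lra.
have {}gg : geodesic d [set: M] x y g by case: gg => ? ? _ ?; split.
have c_half : 0 <= d x y / 2 <= d x y by have := mdist_ge0 x y; lra.
have c_0 : 0 <= (0 : R) <= d x y by rewrite lexx mdist_ge0.
have c_1 : 0 <= d x y <= d x y by rewrite mdist_ge0 lexx.
have [g0 g1 _ gd] := gg.
have xm : d x (g (d x y / 2)) = d x y / 2.
  by rewrite -{1}g0 gd // sub0r normrN ger0_norm //; case/andP: c_half.
exists (g (d x y / 2)); split=> //.
  rewrite -{1}g1 gd // ger0_norm; lra.
move=> q xq.
have [r2 r2lt [cat2 cat2']] : exists2 r', Num.max (d x y) (d x q) < r' & CAT k (closed_mball x r').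
  by apply: cat_ball; rewrite gt_max xy.
move: r2lt; rewrite gt_max => /andP[xyr2 xqr2].
have Bx : closed_mball x r2 x by rewrite /closed_mball /= mdistxx (le_trans (mdist_ge0 x y)) // ltW.
have By : closed_mball x r2 y by exact: ltW.
have Bq : closed_mball x r2 q by exact: ltW.
have yq : d y q <= d x y + d x q by rewrite (metric_sym x y); exact: metric_triangle.
have [h1 hh1] : exists g, geodesic d (closed_mball x r2) y q g.
  by apply: cat2 => //; apply: lt_diam; lra.
have [h2 hh2] : exists g, geodesic d (closed_mball x r2) q x g.
  by apply: cat2 => //; apply: lt_diam; rewrite metric_sym; lra.
pose p (i : 'I_3) := nth x [:: x; y; q] i.
pose g3 (i : 'I_3) := nth g [:: g; h1; h2] i.
have tri : geodesic_triangle d (closed_mball x r2) p g3.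
  case=> [[|[|[|//]]] ?] //=.
  by apply: geodesic_in_ball => //; exact: ltW.
(* Half of the perimeter is at most d x y + d x q < 2 rho, by the triangle inequality for d y q. *)
have per : ((perimeter d p)%:E < 2%:E * model_diam k)%E.
  have -> : perimeter d p = 2 * ((d x y + d y q + d q x) / 2).
    rewrite /perimeter !big_ord_recl big_ord0 /side_length /p /= /bump /=; lra.
  rewrite EFinM lte_pmul2l // lt_diam // (metric_sym q x); lra.
have [p' [g' [tri' sl' cmp]]] := cat2' p g3 tri per.
pose i0 : 'I_3 := ord0.
pose i1 : 'I_3 := lift ord0 ord0.
pose i2 : 'I_3 := lift ord0 (lift ord0 ord0).
have [e0 e1 e2] : [/\ ordS i0 = i1, ordS i1 = i2 & ordS i2 = i0] by split; exact: val_inj.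
have sxy : side_length (model_dist k) p' i0 = d x y by rewrite sl'.
have syq : side_length (model_dist k) p' i1 = d y q by rewrite sl'.
have sqx : side_length (model_dist k) p' i2 = d q x by rewrite sl'.
move: sxy syq sqx; rewrite /side_length e0 e1 e2 => sxy syq sqx.
have [G0 G1 GP GD] := tri' i0.
have [K0 K1 KP KD] := tri' i1.
have [L0 L1 LP LD] := tri' i2.
move: G0 G1 GP GD K0 L0 LP; rewrite e0 e2 sxy sqx => G0 G1 GP GD K0 L0 LP.
have Px : model_plane k (p' i0) by rewrite -G0; exact: GP.
have Py : model_plane k (p' i1) by rewrite -G1; exact: GP.
have Pq : model_plane k (p' i2) by rewrite -L0; apply: LP; rewrite lexx mdist_ge0.
have Pm : model_plane k (g' i0 (d x y / 2)) by exact: GP.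
have mxm : model_dist k (p' i0) (g' i0 (d x y / 2)) = d x y / 2.
  by rewrite -{1}G0 GD // sub0r normrN ger0_norm //; case/andP: c_half.
have mmy : model_dist k (g' i0 (d x y / 2)) (p' i1) = d x y / 2.
  rewrite -{1}G1 GD // ler0_norm; lra.
have := model_midpoint Px Py Pq Pm mxm mmy sxy.
have dC z : model_dist k (p' i2) z = model_dist k z (p' i2).
  rewrite /model_dist; case: ifP => _; last case: ifP => _.
  - by congr (acos (_ * _) / _); rewrite /euclid_dot; apply: eq_bigr => i _; rewrite mulrC.
  - congr (arcosh _ / _); rewrite /lorentz_dot mulrC; congr (_ - _).
    by apply: eq_bigr => i _; rewrite mulrC.
  - congr Num.sqrt; rewrite /euclid_dot; apply: eq_bigr => i _.
    by rewrite !mxE -opprB mulrNN.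
rewrite sqx (dC (p' i1)) syq (metric_sym y q) => <-.
rewrite ler_wpM2r //.
  apply/ltW/cs_gt0 => [k0|]; last by case/andP: c_half.
  have s0 : 0 < Num.sqrt k by rewrite sqrtr_gt0.
  apply: lt_le_trans (rho_le_pi x k0); rewrite ltr_pM2l //; lra.
(* The vertex [q] enters the comparison as the initial point of the third side. *)
have := cmp i0 i2 (d x y / 2) 0 c_half; rewrite /side_length e2 /p /= => cm.
have {cm} : d (g3 i0 (d x y / 2)) (g3 i2 0) <= model_dist k (g' i0 (d x y / 2)) (g' i2 0).
  by apply: cm; rewrite lexx mdist_ge0.
rewrite /g3 /=; have [-> _ _ _] := hh2.
rewrite L0 -dC metric_sym => qm.
have [m1 m2] := model_dist_range Pq Pm.
by apply: md_le => //; exact: mdist_ge0.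
Qed.

End MidpointLaw.

Lemma exists_halving {R : realType} (D e : R) : 0 < e -> exists n, D / 2 ^+ n < e.
Proof.
move=> e0; exists (Num.bound (D / e)).
rewrite ltr_pdivrMr ?exprn_gt0 // mulrC -ltr_pdivrMr //.
exact: upper_nthrootP.
Qed.

(** * Centres in convex hulls *)

Section Hull.
Context {R : realType} {M : metricType R}.
Variables (k rho : R) (mid : M -> M -> M).
Hypothesis k_rho : 0 < k -> Num.sqrt k * rho <= pi / 2.
Hypothesis midP : forall x y, mdist x y < rho -> midpoint_law k rho x y (mid x y).
Implicit Types (x y q m b : M) (s : {fset M}).
Local Notation d := (@mdist _ M).

Lemma scaled_le_pi u : u <= 2 * rho -> 0 < k -> Num.sqrt k * u <= pi.
Proof.
move=> u2 k0; have := k_rho k0; have := sqrtr_ge0 k => s0 h.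
by have := ler_wpM2l s0 u2; lra.
Qed.

Lemma scaled_lt_pihalf u : u < rho -> 0 < k -> Num.sqrt k * u < pi / 2.
Proof.
move=> ur k0; apply: lt_le_trans (k_rho k0).
by rewrite ltr_pM2l // sqrtr_gt0.
Qed.

(** Write the distances from [q] as A + e and A - e. By [mdDB] the midpoint law becomes (md (d q m)
    - md A) cs (c / 2) <= (md e - md (c / 2)) cs A with c = d x y, and the right side is nonpositive
    because |e| <= c / 2. *)
Lemma mid_convex x y q : d x y < rho -> d x q < rho -> d y q < rho ->
  d q (mid x y) <= (d q x + d q y) / 2.
Proof.
move=> xy xq yq; have [xm ym /(_ q xq)] := midP xy.
set A := (d q x + d q y) / 2; set m := mid x y => law.
pose e := (d q x - d q y) / 2.
have [qx qy] : d q x = A + e /\ d q y = A - e by rewrite /A /e; lra.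
have qx0 := mdist_ge0 q x; have qy0 := mdist_ge0 q y; have xy0 := mdist_ge0 x y.
have A0 : 0 <= A by rewrite /A; lra.
have Ar : A < rho by move: xq yq; rewrite (metric_sym x) (metric_sym y) /A; lra.
have e_half : `|e| <= d x y / 2.
  have t1 := metric_triangle q y x; have t2 := metric_triangle q x y.
  by rewrite (metric_sym y x) in t1; rewrite ler_norml /e; lra.
rewrite leNgt; apply/negP => Am.
have qm : d q m <= 2 * rho.
  have := metric_triangle q x m; rewrite xm (metric_sym q x); lra.
have := md_lt (scaled_le_pi qm) A0 Am.
move: law; rewrite qx qy mdDB !cs_md => law.
have csA : 0 < 1 - k * md k A by rewrite -cs_md cs_gt0 //; exact: scaled_lt_pihalf.
have csc : 0 < 1 - k * md k (d x y / 2).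
  by rewrite -cs_md cs_gt0 ?divr_ge0 //; apply: scaled_lt_pihalf; lra.
have eC : md k e <= md k (d x y / 2).
  by rewrite -md_norm md_le //; apply: scaled_le_pi; lra.
move: law csA csc eC; move: (md k A) (md k (d q m)) (md k e) (md k (d x y / 2)) => a u E C.
move=> law csA csc eC au.
have h1 : 0 <= (1 - k * a) * (C - E) by apply: mulr_ge0; [exact: ltW|rewrite subr_ge0].
have h2 : 0 < (u - a) * (1 - k * C) by apply: mulr_gt0; rewrite // subr_gt0.
by move: law h1 h2; lra.
Qed.

Inductive hull s : M -> Prop :=
| hull_gen b : b \in s -> hull s b
| hull_mid x y : hull s x -> hull s y -> d x y < rho -> hull s (mid x y).

Lemma hull_ball s q r x : (forall b, b \in s -> d q b <= r) -> r < rho ->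
  hull s x -> d q x <= r.
Proof.
move=> qs rr; elim=> {x} [b|x y _ qx _ qy xy]; first exact: qs.
have : d q (mid x y) <= (d q x + d q y) / 2.
  by apply: mid_convex => //; rewrite metric_sym (le_lt_trans _ rr).
by lra.
Qed.

(** [hull_ball] is used twice, around each vertex for [x] and then around [x] for [y]. *)
Lemma hull_diam s D x y : (forall a b, a \in s -> b \in s -> d a b <= D) -> D < rho ->
  hull s x -> hull s y -> d x y <= D.
Proof.
move=> sD Dr hx; apply: (hull_ball _ Dr) => b bs.
by rewrite metric_sym; apply: (hull_ball _ Dr) hx => c; exact: sD.
Qed.

(** A short step from [x] in the direction of [y], built from midpoints alone. *)
Definition iter_mid x y n : M := iter n (mid x) y.

Lemma dist_iter_mid x y n : d x y < rho -> d x (iter_mid x y n) = d x y / 2 ^+ n.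
Proof.
move=> xy; elim: n => [|n IH]; first by rewrite expr0 divr1.
have xn : d x (iter_mid x y n) < rho.
  apply: le_lt_trans xy; rewrite IH ler_pdivrMr ?exprn_gt0 // ler_peMr ?mdist_ge0 //.
  by apply: exprn_ege1; lra.
have [xm _ _] := midP xn; rewrite /iter_mid iterS -/(iter_mid x y n) xm IH exprSr.
by rewrite invfM mulrA.
Qed.

Lemma half_le (c : R) n : 0 <= c -> 0 <= c / 2 ^+ n <= c.
Proof.
move=> c0; rewrite divr_ge0 ?exprn_ge0 //= ler_pdivrMr ?exprn_gt0 // ler_peMr //.
by apply: exprn_ege1; lra.
Qed.

Lemma hull_iter_mid s x y n : hull s x -> hull s y -> d x y < rho ->
  hull s (iter_mid x y n).
Proof.
move=> hx hy xy; elim: n => [|n IH] //=; apply: hull_mid => //.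
have := dist_iter_mid n xy; rewrite /iter_mid => ->.
by apply: le_lt_trans xy; case/andP: (half_le n (mdist_ge0 x y)).
Qed.

(* For k = 1 this is the spherical law
   sin c * cos (d q m) >= sin (c - t) * cos (d q x) + sin t * cos (d q y),
   rewritten with [md] so that it also makes sense for k = 0. *)
Lemma iter_mid_law x y q n : d x y < rho -> d x q < rho ->
  let c := d x y in let t := c / 2 ^+ n in
  sn k c * md k (d q (iter_mid x y n)) <=
    sn k (c - t) * md k (d q x) + sn k t * md k (d q y)
    - sn k t * md k c + sn k c * md k t.
Proof.
move=> xy xq /=; set c := d x y.
have c0 : 0 <= c by exact: mdist_ge0.
have snc : 0 <= sn k c.
  move: c0; rewrite le_eqVlt => /predU1P[<-|c0]; first by rewrite sn0.
  apply/ltW/sn_gt0 => // k0; have := scaled_lt_pihalf xy k0.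
  by have := pi_gt0 R; rewrite -/c; lra.
elim: n => [|n IH].
  rewrite expr0 divr1 subrr sn0 /=; lra.
have tn := half_le n c0.
have xn : d x (iter_mid x y n) < rho.
  by rewrite dist_iter_mid // (le_lt_trans _ xy) //; case/andP: tn.
have [_ _ /(_ q xq)] := midP xn.
rewrite dist_iter_mid // -/c /iter_mid iterS -/(iter_mid x y n).
set u' := md k (d q (mid x _)); move: IH tn.
rewrite (_ : c / 2 ^+ n.+1 = c / 2 ^+ n / 2); last by rewrite exprSr invfM mulrA.
move: (md k (d q (iter_mid x y n))) (c / 2 ^+ n) => u t.
move: (md k (d q x)) (md k (d q y)) => ua uE IH tc law.
have csh : 0 < cs k (t / 2).
  by apply: cs_gt0 => [|]; [apply: scaled_lt_pihalf; rewrite -/c in xy; lra|lra].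
(* Multiplication by cs (t / 2) > 0 turns every coefficient at t / 2 into an expression in the
   coefficients at t, so that the induction hypothesis applies. *)
have p1 : sn k (c - t / 2) * cs k (t / 2) = (sn k c + sn k (c - t)) / 2.
  rewrite !snB (sn_half k t) (cs_half k t).
  have := sqr_sn k (t / 2); rewrite !expr2 !(cs_md k (t / 2)) => e.
  by field: e.
have p2 : sn k (t / 2) * cs k (t / 2) = sn k t / 2 by rewrite (sn_half k t); field.
have p3 : md k (t / 2) * cs k (t / 2) = md k t / 2 - md k (t / 2).
  by rewrite (md_half k t); field.
rewrite -(ler_pM2r csh) -[leLHS]mulrA.
apply: le_trans (ler_wpM2l snc law) _.
rewrite [leRHS](_ : _ = (sn k (c - t / 2) * cs k (t / 2)) * ua
  + (sn k (t / 2) * cs k (t / 2)) * (uE - md k c)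
  + sn k c * (md k (t / 2) * cs k (t / 2))); last by ring.
rewrite p1 p2 p3; lra.
Qed.

Lemma sn_ge0 c : 0 <= c -> c < rho -> 0 <= sn k c.
Proof.
rewrite le_eqVlt => /predU1P[<-|c0 cr]; first by rewrite sn0.
apply/ltW/sn_gt0 => // k0; have := scaled_lt_pihalf cr k0.
by have := pi_gt0 R; lra.
Qed.

(** Iterated duplication formula for [sn], with [cs] bounded on [0, D]. It bounds a step of length c
    / 2 ^ n from below uniformly in c, which makes the gain in [descent] uniform. *)
Lemma sn_halving_bound c D n : 0 <= c -> c <= D -> D < rho ->
  sn k c <= (2 * (1 + `|k| * md k D)) ^+ n * sn k (c / 2 ^+ n).
Proof.
move=> c0 cD Dr; elim: n => [|n IH]; first by rewrite !expr0 divr1 mul1r.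
apply: le_trans IH _.
have D0 : 0 <= D by exact: le_trans cD.
have K0 : 0 <= 1 + `|k| * md k D.
  by rewrite addr_ge0 // mulr_ge0 // md_ge0 //; apply: scaled_le_pi; lra.
rewrite exprSr -mulrA ler_wpM2l ?exprn_ge0 ?mulr_ge0 //.
rewrite (_ : c / 2 ^+ n.+1 = c / 2 ^+ n / 2); last by rewrite exprSr invfM mulrA.
have /andP[t0 tc] := half_le n c0; move: (c / 2 ^+ n) t0 tc => t t0 tc.
rewrite (sn_half k t) [leRHS]mulrAC ler_wpM2l //.
  by rewrite mulr_ge0 // sn_ge0; lra.
by apply: cs_bound; [apply: scaled_le_pi|..]; lra.
Qed.

Lemma md_ge0_rho u : 0 <= u -> u < rho -> 0 <= md k u.
Proof. by move=> u0 ur; apply: md_ge0 => //; apply: scaled_le_pi; lra. Qed.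

Lemma md_le_rho u v : 0 <= u -> u <= v -> v < rho -> md k u <= md k v.
Proof. by move=> u0 uv vr; apply: md_le => //; apply: scaled_le_pi; lra. Qed.

Lemma cs_gt0_rho u : 0 <= u -> u < rho -> 0 < cs k u.
Proof. by move=> u0 ur; apply: cs_gt0 => //; exact: scaled_lt_pihalf. Qed.

Lemma cs_bound_rho u v : 0 <= u -> u <= v -> v < rho -> cs k u <= 1 + `|k| * md k v.
Proof. by move=> u0 uv vr; apply: cs_bound => //; apply: scaled_le_pi; lra. Qed.

Lemma sn_gt0_rho u : 0 < u -> u < rho -> 0 < sn k u.
Proof.
move=> u0 ur; apply: sn_gt0 => // k0; have := scaled_lt_pihalf ur k0.
by have := pi_gt0 R; lra.
Qed.

(** Here S and T are [sn] of the full distance and of the step. The gain T xi is linear in T and the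
    error S mt z is quadratic, so for small T half of the gain survives; dividing by S costs the
    factor L. *)
Lemma descent_arith (xi K1 K2 L S T a u mt z : R) :
  0 < xi -> 0 < K1 -> 0 < K2 -> 0 < L -> 0 < S -> 0 < T -> 0 <= mt ->
  S <= K2 -> S <= L * T -> T * (2 * K1 * K2) <= xi -> mt <= T ^+ 2 -> 0 <= z -> z <= K1 ->
  S * (u - a) <= S * mt * z - T * xi -> u <= a - xi / 2 / L.
Proof.
move=> xi0 K10 K20 L0 S0 T0 mt0 SK SL TK mT z0 zK h.
have b1 : S * mt * z <= K2 * T ^+ 2 * K1.
  by apply: ler_pM => //; [rewrite mulr_ge0 // ltW|apply: ler_pM => //; exact: ltW].
have b2 := ler_wpM2l (ltW T0) TK.
have b3 : S * (u - a) <= - (T * xi / 2) by rewrite expr2 in b1; lra.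
have b4 : xi / 2 / L * S <= T * xi / 2.
  rewrite [leLHS](_ : _ = xi / 2 * (S / L)); last by field; exact: lt0r_neq0.
  rewrite [leRHS](_ : _ = xi / 2 * T); last by field.
  by rewrite ler_pM2l ?divr_gt0 // ler_pdivrMr // mulrC.
rewrite -(ler_pM2l S0); lra.
Qed.

(** In the triangle [x], [y], [q] the side opposite to [x] is shorter than d x y, which makes the
    angle at [x] acute in the model: a short step from [x] towards [y] approaches [q]. Both the
    number of halvings and the gain are independent of the points. *)
Lemma descent E C0 D : 0 <= E -> E < C0 -> C0 <= D -> D < rho ->
  exists2 eta, 0 < eta & exists n, forall x y q,
    C0 <= d x y -> d x y <= D -> d q x <= E -> d q y <= E ->
    md k (d q (iter_mid x y n)) <= md k (d q x) - eta.
Proof.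
move=> E0 EC CD Dr.
have C00 : 0 < C0 by exact: le_lt_trans EC.
have D0 : 0 < D by exact: lt_le_trans CD.
have Er : E < rho by apply: le_lt_trans Dr; apply: le_trans CD; exact: ltW.
have mdD0 : 0 <= md k D by exact: md_ge0_rho (ltW D0) Dr.
have mdE0 : 0 <= md k E by exact: md_ge0_rho.
(* [xi] is the first-order gain; K1 and K3 bound [cs] on [0, E] and [0, D], and K2 bounds [sn] on
   [0, D] through sn <= 1 + sn ^ 2. *)
pose xi := md k C0 - md k E.
have xi0 : 0 < xi.
  by rewrite subr_gt0; apply: md_lt => //; apply: scaled_le_pi; lra.
pose K1 := 1 + `|k| * md k E.
pose K3 := 1 + `|k| * md k D.
pose K2 := 1 + md k D * (1 + K3).
have K10 : 0 < K1 by rewrite ltr_pwDl // mulr_ge0.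
have K30 : 0 < K3 by rewrite ltr_pwDl // mulr_ge0.
have K20 : 0 < K2 by rewrite ltr_pwDl // mulr_ge0 // addr_ge0 // ltW.
have K0 : 0 < 2 * K1 * K2 by rewrite !mulr_gt0.
have eps0 : 0 < xi / (2 * K1 * K2) by rewrite divr_gt0.
have /cvgrPdist_lt/(_ _ eps0) := @continuous_sn R k 0.
rewrite sn0 => /nbhs_ballP[s1 /= s10 sn_small].
have [n Dn] := exists_halving D s10.
have Kn0 : 0 < (2 * K3) ^+ n by rewrite exprn_gt0 // mulr_gt0.
exists (xi / 2 / (2 * K3) ^+ n); first by rewrite !divr_gt0.
exists n => x y q xyC xyD qx qy.
have xy : d x y < rho by exact: le_lt_trans Dr.
have xq : d x q < rho by rewrite metric_sym; exact: le_lt_trans Er.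
have := iter_mid_law n xy xq; rewrite /=.
have snK := sn_halving_bound n (mdist_ge0 x y) xyD Dr; rewrite -/K3 in snK.
have c0 : 0 < d x y by exact: lt_le_trans xyC.
have /andP[_ tc] := half_le n (ltW c0).
have t0 : 0 < d x y / 2 ^+ n by rewrite divr_gt0 ?exprn_gt0.
have tD : d x y / 2 ^+ n <= D / 2 ^+ n by rewrite ler_wpM2r // invr_ge0 exprn_ge0.
have tr : d x y / 2 ^+ n < rho by exact: le_lt_trans xy.
move: (d x y) (d x y / 2 ^+ n) => c t in xyC xyD xy snK c0 tc t0 tD tr *.
have snt0 : 0 < sn k t by exact: sn_gt0_rho.
have snt : sn k t * (2 * K1 * K2) <= xi.
  have := sn_small t; rewrite /ball /= !sub0r !normrN !gtr0_norm //.
  by move=> /(_ (le_lt_trans tD Dn)); rewrite ltr_pdivlMr // => /ltW.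
have snc0 : 0 < sn k c by exact: sn_gt0_rho.
have sncK : sn k c <= K2.
  have csK : cs k c <= K3 by apply: cs_bound_rho => //; exact: ltW.
  have mdcD : md k c <= md k D by apply: md_le_rho => //; exact: ltW.
  have mdc0 : 0 <= md k c by apply: md_ge0_rho => //; exact: ltW.
  have csc : 0 < cs k c by apply: cs_gt0_rho => //; exact: ltW.
  have sq : sn k c ^+ 2 <= md k D * (1 + K3).
    rewrite sqr_sn; apply: ler_pM => //; last by rewrite lerD2l.
    by rewrite addr_ge0 // ltW.
  apply: le_trans (_ : 1 + sn k c ^+ 2 <= _); last by rewrite lerD2l.
  by have := sqr_ge0 (sn k c - 1); have := sqr_ge0 (sn k c); rewrite !expr2; lra.
have mdt0 : 0 <= md k t by apply: md_ge0_rho => //; exact: ltW.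
have mdt : md k t <= sn k t ^+ 2.
  rewrite sqr_sn mulrDr mulr1 lerDl mulr_ge0 //.
  by apply/ltW/cs_gt0_rho => //; exact: ltW.
have mdC : md k C0 <= md k c by apply: md_le_rho => //; exact: ltW.
have mdqy : md k (d q y) <= md k E by apply: md_le_rho => //; exact: mdist_ge0.
have qxr : d q x < rho by rewrite metric_sym.
have mdqx : 0 <= md k (d q x) by apply: md_ge0_rho => //; exact: mdist_ge0.
have csqx : cs k (d q x) <= K1 by apply: cs_bound_rho => //; exact: mdist_ge0.
have csqx0 : 0 < cs k (d q x) by apply: cs_gt0_rho => //; exact: mdist_ge0.
have csc0 : 0 < cs k c by apply: cs_gt0_rho => //; exact: ltW.
move=> law.
apply: (@descent_arith xi K1 K2 _ (sn k c) (sn k t) _ _ (md k t) (cs k (d q x))) => //.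
  exact: ltW.
have h1 : 0 <= sn k t * (md k c - md k C0) by rewrite mulr_ge0 ?subr_ge0 // ltW.
have h2 : 0 <= sn k t * (md k E - md k (d q y)) by rewrite mulr_ge0 ?subr_ge0 // ltW.
have h3 : 0 <= sn k t * cs k c * md k (d q x) by rewrite !mulr_ge0 // ltW.
move: law h1 h2 h3; rewrite snB (cs_md k t) (cs_md k (d q x)) /xi; lra.
Qed.

(* If every point of the hull were at distance at least [C0] from some vertex, moving
   towards that vertex would decrease the distance to [y] by a fixed amount forever. *)
Lemma hull_center s y E C0 D : s != fset0 -> 0 <= E -> E < C0 -> D < rho -> E < rho ->
  (forall a b, a \in s -> b \in s -> d a b <= D) ->
  (forall b, b \in s -> d y b <= E) ->
  exists2 z, hull s z & forall b, b \in s -> d z b < C0.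
Proof.
move=> /fset0Pn[a as_] E0 EC Dr Er sD yE.
apply: contrapT => noz.
have far z : hull s z -> exists2 b, b \in s & C0 <= d z b.
  move=> hz; apply: contrapT => nob; apply: noz; exists z => // b bs.
  by rewrite ltNge; apply/negP => zb; apply: nob; exists b.
have CD : C0 <= D.
  have [b bs ab] := far _ (hull_gen as_).
  by apply: le_trans ab _; exact: sD.
have [eta eta0 [n desc]] := descent E0 EC CD Dr.
(* The iteration never leaves the hull, hence stays within E of [y], and [descent] applies at every
   step. *)
have yh z : hull s z -> d y z <= E by exact: hull_ball.
have step (i : nat) : exists2 z, hull s z & md k (d y z) <= md k E - eta * i%:R.
  elim: i => [|i [z hz zm]].
    exists a; first exact: hull_gen.
    rewrite mulr0 subr0; apply: md_le_rho => //; [exact: mdist_ge0|exact: yE].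
  have [b bs zb] := far _ hz.
  have hb := hull_gen bs.
  have zbD : d z b <= D by exact: (hull_diam sD).
  exists (iter_mid z b n).
    by apply: hull_iter_mid => //; exact: le_lt_trans Dr.
  apply: le_trans (desc z b y zb zbD (yh _ hz) (yh _ hb)) _.
  by rewrite -natr1; lra.
pose i := Num.bound (md k E / eta).
have [z hz zm] := step i.
have := md_ge0_rho (mdist_ge0 y z) (le_lt_trans (yh _ hz) Er).
have : md k E / eta < i%:R.
  by apply: archi_boundP; rewrite divr_ge0 ?(ltW eta0) //; exact: md_ge0_rho.
rewrite ltr_pdivrMr //; lra.
Qed.

(** A substitute for the point with parameter [t] on a geodesic from [x] to [y]: only the convexity
    bound towards [s] is retained. *)
Definition affine_point s x y t p :=
  hull s p /\ forall b, b \in s -> d b p <= (1 - t) * d b x + t * d b y.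

(** Bisection of the parameter interval; both ends are carried along since the next point is their
    midpoint. *)
Lemma dyadic_points s D x y t n : (forall a b, a \in s -> b \in s -> d a b <= D) ->
  D < rho -> hull s x -> hull s y -> 0 <= t <= 1 ->
  exists t1 t2 p1 p2, [/\ 0 <= t1, t1 <= t <= t2, t2 - t1 = 1 / 2 ^+ n,
    affine_point s x y t1 p1 & affine_point s x y t2 p2].
Proof.
move=> sD Dr hx hy t01; elim: n => [|n [t1 [t2 [p1 [p2 [t10 tt t21 [h1 a1] [h2 a2]]]]]]].
  exists 0, 1, x, y; split=> //; first by rewrite expr0 divr1 subr0.
    by split=> // b bs; lra.
  by split=> // b bs; lra.
have r12 : d p1 p2 < rho by apply: (le_lt_trans _ Dr); exact: hull_diam sD Dr h1 h2.
have am : affine_point s x y ((t1 + t2) / 2) (mid p1 p2).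
  split=> [|b bs]; first exact: hull_mid.
  have hb := hull_gen bs.
  apply: le_trans (mid_convex r12 _ _) _.
  - by apply: (le_lt_trans _ Dr); exact: hull_diam sD Dr h1 hb.
  - by apply: (le_lt_trans _ Dr); exact: hull_diam sD Dr h2 hb.
  - by have := a1 b bs; have := a2 b bs; lra.
have e2 : 1 / 2 ^+ n.+1 = (1 / 2 ^+ n) / 2 :> R by rewrite exprSr invfM mulrA.
have [tm|tm] := lerP t ((t1 + t2) / 2).
- exists t1, ((t1 + t2) / 2), p1, (mid p1 p2); split=> //.
    by case/andP: tt => -> _.
  by rewrite e2 -t21; lra.
- exists ((t1 + t2) / 2), t2, (mid p1 p2), p2; split=> //; first by case/andP: tt; lra.
    by case/andP: tt => _ ->; rewrite ltW.
  by rewrite e2 -t21; lra.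
Qed.

End Hull.

(** * Partial contraction towards a centre *)

Section PartialContraction.
Context {R : realType} {M : metricType R}.
Implicit Types (s : {fset M}).
Local Notation d := (@mdist _ M).

(* Moving a vertex [a] towards an approximate centre [z] at distance [E ~ J * D] from [s]
   by [r] lowers the bound on the distances to [s] from [D] to about
   [D - r * (D - E) / E ~ D - r * (1 - J) / J = D - 2 * e]. *)
Lemma contracted_point k delta e J mid s :
  (0 < k -> Num.sqrt k * (delta + e) <= pi / 2) ->
  (forall x y, d x y < delta + e -> midpoint_law k (delta + e) x y (mid x y)) ->
  0 < J -> J < 1 -> 0 <= e -> 0 < delta -> e <= (1 - J) / (1 + J) * delta ->
  s != fset0 -> (forall a b, a \in s -> b \in s -> d a b <= fdiam s) ->
  0 <= fdiam s -> fdiam s < delta + e ->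
  (forall E, J * fdiam s < E -> exists y, forall b, b \in s -> d y b <= E) ->
  exists2 p, hull (delta + e) mid s p &
    (exists2 a, a \in s & d a p <= 2 * J / (1 - J) * e) /\
    (forall b, b \in s -> d b p < delta - e).
Proof.
move=> k_rho midP J0 J1 e0 delta0 eJ s0; move: (fdiam s) => D sD D0 Drho center.
have [a as_] := fset0Pn _ s0.
have J1' : 0 < 1 - J by rewrite subr_gt0.
(* The assumed bound on [e], solved for the two scales. *)
have Jd : J * (delta + e) <= delta - e.
  have J2 : 0 < 1 + J by rewrite addr_gt0.
  have := ler_wpM2l (ltW J2) eJ; rewrite [leRHS](_ : _ = (1 - J) * delta); [lra|by field; exact: lt0r_neq0].
set r := 2 * J / (1 - J) * e.
have rJ : r * (1 - J) = 2 * J * e by rewrite /r mulrAC divfK ?lt0r_neq0.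
have r0 : 0 <= r by rewrite mulr_ge0 // divr_ge0 ?mulr_ge0 // ltW.
have de0 : 0 < delta - e.
  by apply: lt_le_trans Jd; rewrite mulr_gt0 // ltr_pwDl.
clearbody r.
move: D0; rewrite le_eqVlt => /predU1P[D0|D0].
  exists a; first exact: hull_gen.
  split=> [|b bs]; first by exists a; rewrite ?mdistxx.
  by apply: le_lt_trans de0; rewrite D0 sD.
have JD0 : 0 < J * D by rewrite mulr_gt0.
have JDd : J * D < delta - e by apply: lt_le_trans Jd; rewrite ltr_pM2l.
(* E * G < r * D is the wanted bound (1 - r / E) D + (r / E) E < delta - e multiplied by E. It holds
   for E slightly above J D, because r - J G = J (delta + e - D) > 0. *)
pose G := D + r - (delta - e).
have JG : J * G < r.
  have : J * (D - (delta + e)) < 0 by rewrite pmulr_rlt0 // subr_lt0.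
  by rewrite /G; lra.
have [E [JDE Ed EG]] : exists E, [/\ J * D < E, E < delta - e & E * G < r * D].
  have [G0|G0] := lerP G 0.
    exists ((J * D + (delta - e)) / 2); split; [lra|lra|].
    move: G0; rewrite le_eqVlt => /predU1P[G0|G0].
      by rewrite G0 mulr0 mulr_gt0 //; move: JG; rewrite G0 mulr0.
    apply: lt_le_trans (_ : 0 <= _); last by rewrite mulr_ge0 // ltW.
    by rewrite pmulr_rlt0 //; lra.
  have h : J * D < r * D / G.
    rewrite ltr_pdivlMr // mulrAC ltr_pM2r //.
  have [l|l] := lerP (delta - e) (r * D / G).
    exists ((J * D + (delta - e)) / 2); split; [lra|lra|].
    by rewrite -ltr_pdivlMr //; lra.
  exists ((J * D + r * D / G) / 2); split; [lra|lra|].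
  by rewrite -ltr_pdivlMr //; lra.
have E0 : 0 < E by exact: lt_trans JDE.
have [y yE] : exists y, forall b, b \in s -> d y b <= (J * D + E) / 2.
  by apply: center; lra.
have [z hz zE] : exists2 z, hull (delta + e) mid s z & forall b, b \in s -> d z b < E.
  by apply: (hull_center k_rho midP s0 _ _ Drho _ sD yE); lra.
(* If the centre is within reach of a displacement [r], it is itself the point sought. *)
have [Er|rE] := lerP E r.
  exists z => //; split=> [|b bs].
    by exists a => //; rewrite metric_sym (le_trans _ Er) // ltW // zE.
  by rewrite metric_sym; apply: lt_trans Ed; exact: zE.
have t01 : 0 <= r / E <= 1 by rewrite divr_ge0 ?(ltW E0) //= ler_pdivrMr // mul1r ltW.
set t := r / E in t01.
have tE : t * E = r by rewrite divfK ?lt0r_neq0.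
have gap : 0 < (delta - e) - ((1 - t) * D + t * E).
  rewrite -(pmulr_rgt0 _ E0).
  rewrite [X in 0 < X](_ : _ = r * D - E * G); first by rewrite subr_gt0.
  by rewrite /G; move: tE; clear; move=> tE; rewrite -tE; ring.
(* The ratio t = r / E need not be dyadic. It is rounded down, which keeps the displacement below
   [r] and raises the distances by at most D / 2 ^ n, less than the available gap. *)
have [n Dn] := exists_halving D gap.
have ha := hull_gen (delta + e) mid as_.
have [t1 [t2 [p1 [_ [t10 tt t21 [hp1 ap1] _]]]]] :=
  dyadic_points k_rho midP n sD Drho ha hz t01.
have t1t : t1 <= t by case/andP: tt.
have tt1 : t - t1 <= 1 / 2 ^+ n by rewrite -t21; case/andP: tt => _; lra.
have t11 : 0 <= 1 - t1 by case/andP: t01 => _; lra.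
exists p1 => //; split=> [|b bs].
  exists a => //; apply: le_trans (ap1 a as_) _.
  rewrite mdistxx mulr0 add0r -tE; apply: ler_pM => //; first exact: mdist_ge0.
  by rewrite metric_sym ltW // zE.
apply: le_lt_trans (ap1 b bs) _.
have h1 : (1 - t1) * d b a <= (1 - t1) * D by rewrite ler_wpM2l // sD.
have h2 : t1 * d b z <= t1 * E by rewrite ler_wpM2l // metric_sym ltW // zE.
have h3 : (t - t1) * (D - E) <= 1 / 2 ^+ n * D.
  apply: le_trans (_ : (t - t1) * D <= _); first by rewrite ler_wpM2l ?subr_ge0 //; lra.
  by rewrite ler_wpM2r // ltW.
rewrite mul1r mulrC in h3; lra.
Qed.
End PartialContraction.

Section PartialCenters.
Context {R : realType} {M : metricType R}.
Implicit Types (s t A : {fset M}) (x y a b : M).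
Local Notation d := (@mdist _ M).

Lemma mdist_le_fdiam A a b : a \in A -> b \in A -> d a b <= fdiam A.
Proof.
move=> aA bA; apply: le_trans (@le_bigmax_seq _ _ _ A 0 b xpredT (d a) bA isT) _.
exact: (@le_bigmax_seq _ _ _ A 0 a xpredT (fun c => \big[Num.max/0]_(b <- A) d c b) aA isT).
Qed.

Lemma fdiam_ge0 A : 0 <= fdiam A.
Proof. exact: bigmax_ge_id. Qed.

Lemma fdiam_lt A c : 0 < c -> (forall a b, a \in A -> b \in A -> d a b < c) -> fdiam A < c.
Proof.
move=> c0 Ac; rewrite bigmax_seq_ltE c0; apply/allP => a aA.
by rewrite bigmax_seq_ltE c0; apply/allP => b bA; exact: Ac.
Qed.

Lemma circumradius_le_fdiam A : A != fset0 -> circumradius A <= fdiam A.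
Proof.
move=> /fset0Pn[a aA]; apply: le_trans (_ : \big[Num.max/0]_(b <- A) d a b <= _).
  apply: ge_inf; last by exists a.
  by exists 0 => _ [x _ <-]; exact: bigmax_ge_id.
by rewrite bigmax_seq_leE fdiam_ge0; apply/allP => b; exact: mdist_le_fdiam.
Qed.

Lemma jung_bound (rho : \bar R) A : 0 < fdiam A -> ((fdiam A)%:E < rho)%E ->
  circumradius A <= jung M rho * fdiam A.
Proof.
move=> A0 Ar; rewrite -ler_pdivrMr //; apply: ub_le_sup; last by exists A.
exists 1 => _ [B [B0 _] <-]; rewrite ler_pdivrMr // mul1r.
apply: circumradius_le_fdiam; apply: contraTneq B0 => ->.
by rewrite /fdiam big_nil ltxx.
Qed.

Lemma jung_le1 (rho : \bar R) : 0 < jung M rho -> jung M rho <= 1.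
Proof.
rewrite /jung; set S := [set _ | _ in _] => S0.
have [S0'|/set0P SN] := eqVneq S set0; first by move: S0; rewrite S0' sup0 ltxx.
apply: ge_sup => // _ [B [B0 _] <-]; rewrite ler_pdivrMr // mul1r.
apply: circumradius_le_fdiam; apply: contraTneq B0 => ->.
by rewrite /fdiam big_nil ltxx.
Qed.

Lemma jung_gt0_point (rho : \bar R) : 0 < jung M rho -> exists x : M, True.
Proof.
rewrite /jung; set S := [set _ | _ in _] => S0.
have [S0'|/set0P[_ [A [A0 _] _]]] := eqVneq S set0.
  by move: S0; rewrite S0' sup0 ltxx.
have [A0'|/fset0Pn[x _]] := eqVneq A fset0; last by exists x.
by move: A0; rewrite A0' /fdiam big_nil ltxx.
Qed.

Lemma near_center A E : A != fset0 -> circumradius A < E ->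
  exists y, forall b, b \in A -> d y b <= E.
Proof.
move=> /fset0Pn[a aA] /inf_lt[|_ [y _ <-] yE]; first by exists (\big[Num.max/0]_(b <- A) d a b), a.
exists y => b bA; apply: le_trans (ltW yE); exact: le_bigmax_seq.
Qed.

Lemma partial_centers (k delta e : R) (rho : \bar R) :
  ((delta + e)%:E <= rho)%E -> (rho <= cat_radius M k)%E -> 0 < delta -> 0 <= e ->
  0 < jung M rho -> e <= (1 - jung M rho) / (1 + jung M rho) * delta ->
  exists p : {fset M} -> M, forall s, s != fset0 ->
    (forall a b, a \in s -> b \in s -> d a b < delta + e) ->
    [/\ exists2 a, a \in s & d a (p s) <= jung_slope M rho * e,
        forall b, b \in s -> d b (p s) < delta - e &
        forall t, t != fset0 -> (t `<=` s)%fset -> d (p t) (p s) < delta - e].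
Proof.
move=> der rhoM delta0 e0 J0 eJ.
have [x0 _] := jung_gt0_point J0.
(* Midpoints are taken at the real scale [delta + e], as [rho] may be +oo. *)
have derM : ((delta + e)%:E <= cat_radius M k)%E by exact: le_trans rhoM.
have [mid midP] : exists mid : M -> M -> M, forall x y, d x y < delta + e ->
    midpoint_law k (delta + e) x y (mid x y).
  have /choice[mid midP] : forall u : M * M, exists m, d u.1 u.2 < delta + e ->
      midpoint_law k (delta + e) u.1 u.2 m.
    move=> [x y] /=; have [xy|nxy] := pselect (d x y < delta + e); last by exists x.
    by have [m mP] := midpoint_exists derM xy; exists m.
  by exists (fun x y => mid (x, y)) => x y; exact: (midP (x, y)).
have k_rho := rho_le_pi derM x0.
have J1 := jung_le1 J0.
set J := jung M rho in J0 J1 eJ *.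
have de0 : 0 < delta - e.
  have J2 : 0 < 1 + J by lra.
  have : e * (1 + J) <= (1 - J) * delta.
    by rewrite -ler_pdivlMr // mulrAC.
  have := mulr_gt0 J0 delta0; have := mulr_ge0 (ltW J0) e0; nra.
have /choice[p pP] : forall s, exists q, s != fset0 ->
    (forall a b, a \in s -> b \in s -> d a b < delta + e) ->
    hull (delta + e) mid s q /\
    ((exists2 a, a \in s & d a q <= jung_slope M rho * e) /\
    forall b, b \in s -> d b q < delta - e).
  move=> s; have [->|s0] := eqVneq s fset0; first by exists x0.
  have [sd|nsd] := pselect (forall a b, a \in s -> b \in s -> d a b < delta + e);
    last by exists x0 => _ /nsd.
  have sdiam : fdiam s < delta + e by apply: fdiam_lt => //; lra.
  move: J1; rewrite le_eqVlt => /predU1P[J1|J1].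
    (* For J = 1 the bound forces e = 0, and a vertex of [s] can be kept in place whatever the value
       of the slope. *)
    have e_eq0 : e = 0.
      by apply/eqP; rewrite eq_le e0 andbT (le_trans eJ) // J1 subrr !mul0r.
    have [a as_] := fset0Pn _ s0; exists a => _ _; split; first exact: hull_gen.
    split; first by exists a; rewrite // mdistxx e_eq0 mulr0.
    by move=> b bs; have := sd b a bs as_; rewrite e_eq0 addr0 subr0.
  have [|q hq qP] := contracted_point k_rho midP J0 J1 e0 delta0 eJ s0
    (@mdist_le_fdiam s) (fdiam_ge0 s) sdiam; last by exists q.
  move=> E JE; have := fdiam_ge0 s; rewrite le_eqVlt => /predU1P[s_eq0|s_gt0].
    have [a as_] := fset0Pn _ s0; exists a => b bs.
    apply: le_trans (mdist_le_fdiam as_ bs) _.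
    by move: JE; rewrite -s_eq0 mulr0 => /ltW.
  apply: near_center => //; apply: le_lt_trans JE; apply: jung_bound => //.
  by apply: lt_le_trans der; rewrite lte_fin.
exists p => s s0 sd; have [hs [ps1 ps2]] := pP s s0 sd; split=> // t t0 ts.
have [ht _] : hull (delta + e) mid t (p t) /\
    ((exists2 a, a \in t & d a (p t) <= jung_slope M rho * e) /\
    forall b, b \in t -> d b (p t) < delta - e).
  by apply: pP => // a b /(fsubsetP ts) ? /(fsubsetP ts); exact: sd.
(* Finiteness of [s] gives one radius strictly below [delta - e], as required by the closed balls of
   [hull_ball]. *)
have r_lt : \big[Num.max/0]_(b <- s) d b (p s) < delta - e.
  by rewrite bigmax_seq_ltE de0; apply/allP => b; exact: ps2.
apply: (le_lt_trans _ r_lt); rewrite metric_sym.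
apply: (hull_ball k_rho midP _ _ ht); last first.
  by apply: lt_le_trans r_lt _; lra.
move=> b /(fsubsetP ts) bs; rewrite metric_sym.
exact: (@le_bigmax_seq _ _ _ s 0 b xpredT (fun b => d b (p s)) bs isT).
Qed.

End PartialCenters.

(** * Homotopies in the persistent homotopy category *)

Section CylinderProjection.
Context {R : realType} {X : topologicalType}.

Lemma within_pair {T U V : topologicalType} (A : set T) (f : T -> U) (g : T -> V) :
  {within A, continuous f} -> {within A, continuous g} ->
  {within A, continuous (fun t => (f t, g t))}.
Proof. by move=> cf cg t; apply: cvg_pair; [exact: cf|exact: cg]. Qed.

Lemma within_postcomp {T U V : topologicalType} (A : set T) (f : T -> U) (g : U -> V) :
  {within A, continuous f} -> continuous g -> {within A, continuous (g \o f)}.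
Proof. by move=> cf cg t; exact: cvg_comp (cf t) (cg (f t)). Qed.

Lemma within_snd {T U V : topologicalType} (A : set T) (B : set U) (f : U -> V) :
  {within B, continuous f} -> {within A `*` B, continuous (f \o snd)}.
Proof.
move=> /subspace_continuousP cf; apply/subspace_continuousP => -[a b] [/= Aa Bb].
move=> P nP; have /= nb := cf b Bb P nP.
have h := @cvg_snd _ _ (nbhs a) (nbhs b) (nbhs_filter a) _ nb.
change (nbhs (a, b) (fun z : T * U => B z.2 -> P (f z.2))) in h.
change (nbhs (a, b) (fun z : T * U => (A `*` B) z -> P (f z.2))).
by apply: (filterS _ h) => -[x y] /= PB [_ By]; exact: PB.
Qed.

(** The line is convex, so second coordinates of paths and of spheroids are joined linearly. With
    the whole line as factor, the deformations must be defined at every real time. *)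
Lemma cylinder_projection_weak_equivalence :
  weak_equivalence R (fst : X * R -> X).
Proof.
split; first split.
- move=> [x s] [y t] [g [gc g0 g1]].
  exists (fun r => (g r, s + r * (t - s))); split.
  + apply: within_pair => //; apply: continuous_subspaceT => r.
    by apply: cvgD; [exact: cvg_cst|apply: cvgMl; exact: cvg_id].
  + by rewrite g0 mul0r addr0.
  + by rewrite g1 mul1r addrC subrK.
- move=> y; exists (y, 0); exists (fun=> y); split => //.
  by apply: continuous_subspaceT => r; exact: cvg_cst.
move=> n [x u] n0; split.
- move=> a b [ac ax] [bc bx] [h [hc h0 h1 hx]].
  exists (fun z => (h z, (1 - z.1) * (a z.2).2 + z.1 * (b z.2).2)); split.
  + apply: within_pair => //.
    have snd_cont : continuous (snd : X * R -> R) by move=> z; exact: cvg_snd.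
    have ca := within_snd (A := [set` `[(0 : R), 1]]) (within_postcomp ac snd_cont).
    have cb := within_snd (A := [set` `[(0 : R), 1]]) (within_postcomp bc snd_cont).
    have c1 : {within [set` `[(0 : R), 1]] `*` @cube R n, continuous (fun z : R * 'rV[R]_n => z.1)}.
      by apply: continuous_subspaceT => z; exact: cvg_fst.
    move=> z; apply: cvgD; apply: cvgM; [|exact: ca|exact: c1|exact: cb].
    by apply: cvgB; [exact: cvg_cst|exact: c1].
  + move=> t ct; rewrite h0 //= subr0 mul1r mul0r addr0; by case: (a t).
  + move=> t ct; rewrite h1 //= subrr mul1r mul0r add0r; by case: (b t).
  + move=> s t s01 bt; rewrite hx //= ax // bx //=; congr pair; ring.
- move=> c [cc cx]; exists (fun t => (c t, u)).
    split; first by apply: within_pair => //; apply: continuous_subspaceT; exact: cst_continuous.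
    by move=> t bt; rewrite cx.
  exists (fun z => c z.2); split => //; last by move=> s t _ bt; exact: cx.
  exact: within_snd.
Qed.
End CylinderProjection.

Section CylinderFunctor.
Variables (R : realType) (N : nat).
Implicit Types F G : persistent_space R N.

Lemma cylinder_map_continuous (X Y : topologicalType) (f : continuousType X Y) :
  continuous (fun z : X * R => (f z.1, z.2)).
Proof.
move=> z.
have cf : {for z, continuous (fun z : X * R => f z.1)}.
  apply: (@continuous_comp _ _ _ (fst : X * R -> X) (f : X -> Y)); first exact: cvg_fst.
  exact: (@cts_fun _ _ f).
have cs : {for z, continuous (snd : X * R -> R)} by exact: cvg_snd.
exact: (cvg_pair cf cs).
Qed.

Lemma cylinder_section_continuous (X : topologicalType) (s : R) :
  continuous (fun x : X => (x, s)).
Proof. by move=> x; exact: (cvg_pair cvg_id (cvg_cst s)). Qed.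

Lemma cylinder_fst_continuous (X : topologicalType) : continuous (fst : X * R -> X).
Proof. by move=> x; exact: cvg_fst. Qed.

Definition cylinder F : persistent_space R N.
Proof.
refine (@Functor (RN R N) Top (fun u => (F u * R)%type : topologicalType)
  (fun u v uv => [the continuousType _ _ of
     mkcts (cylinder_map_continuous (f := fun_mor F uv : continuousType (F u) (F v)))]) _ _).
- move=> u; apply/continuousEP => -[x s] /=.
  by congr pair; rewrite fun_mor_id.
- move=> u v w g f; apply/continuousEP => -[x s] /=.
  by congr pair; rewrite fun_mor_comp.
Defined.

Definition cylinder_section F (s : R) : nat_trans F (cylinder F).
Proof.
exists (fun u => [the continuousType _ _ of
  mkcts (@cylinder_section_continuous (F u) s)] : @mor Top (F u) (cylinder F u)).
by move=> u v uv; apply/continuousEP.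
Defined.

Definition cylinder_projection F : nat_trans (cylinder F) F.
Proof.
exists (fun u => [the continuousType _ _ of
  mkcts (@cylinder_fst_continuous (F u))] : @mor Top (cylinder F u) (F u)).
by move=> u v uv; apply/continuousEP.
Defined.

Local Notation W := (@objectwise_weak_equivalence R N).
Local Notation loc := (fun_mor (loc_functor W)).

(* All sections of the cylinder projection are inverted by the same formal inverse. *)
Lemma ho_cylinder_section F (s t : R) :
  loc (cylinder_section F s : @mor (persistent_space R N) _ _) =
  loc (cylinder_section F t : @mor (persistent_space R N) _ _).
Proof.
have prW : W (cylinder_projection F : @mor (persistent_space R N) _ _).
  by move=> u; exact: cylinder_projection_weak_equivalence.
pose q : @mor (hoTopRN R N) F (cylinder F) := word_class (word_inv prW).
have qpr : q \oc loc (cylinder_projection F : @mor (persistent_space R N) _ _) =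
    @idc (hoTopRN R N) (cylinder F).
  by rewrite /= loc_compE; apply/word_class_eq; exact: word_eq_invl.
suff E r : loc (cylinder_section F r : @mor (persistent_space R N) _ _) = q by rewrite !E.
rewrite -[LHS](@comp_idl (hoTopRN R N)) -qpr.
rewrite -(@comp_assoc (hoTopRN R N)).
rewrite -(fun_mor_comp (loc_functor W)).
have -> : (cylinder_projection F : @mor (persistent_space R N) _ _) \oc
    (cylinder_section F r : @mor (persistent_space R N) _ _) = idc (F : persistent_space R N).
  by apply: nat_trans_eq => u; apply/continuousEP.
by rewrite fun_mor_id (@comp_idr (hoTopRN R N)).
Qed.

Lemma ho_homotopy F G (h : @mor (persistent_space R N) (cylinder F) G) (s t : R) :
  loc (h \oc (cylinder_section F s : @mor (persistent_space R N) _ _)) =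
  loc (h \oc (cylinder_section F t : @mor (persistent_space R N) _ _)).
Proof. by rewrite !fun_mor_comp (ho_cylinder_section F s t). Qed.

Lemma ho_shift_loc (e : R) F G (f : @mor (persistent_space R N) F G) :
  fun_mor (ho_shift N e) (loc f) = loc (fun_mor (pshift N e) f).
Proof. by apply/word_class_eq; exact: (word_map_eq _ (word_repr_eq _)). Qed.

Local Notation PS := (persistent_space R N).
Local Notation sec F s := (cylinder_section F s : @mor PS F (cylinder F)).

(** Each composite is joined to the structure map by two homotopies, both run from time 1 to time
    0. *)
Lemma interleaved_of_homotopies (e : R) (e0 : 0 <= e) F G
    (phi : @mor PS F (pshift N e G)) (psi : @mor PS G (pshift N e F))
    (h1 h2 : @mor PS (cylinder F) (pshift N e (pshift N e F)))
    (h3 h4 : @mor PS (cylinder G) (pshift N e (pshift N e G))) :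
  fun_mor (pshift N e) psi \oc phi = h1 \oc sec F 1 ->
  h1 \oc sec F 0 = h2 \oc sec F 1 ->
  h2 \oc sec F 0 = (structure_map e0 (pshift N e F) : @mor PS _ _) \oc structure_map e0 F ->
  fun_mor (pshift N e) phi \oc psi = h3 \oc sec G 1 ->
  h3 \oc sec G 0 = h4 \oc sec G 1 ->
  h4 \oc sec G 0 = (structure_map e0 (pshift N e G) : @mor PS _ _) \oc structure_map e0 G ->
  interleaved e F G.
Proof.
move=> E1 E2 E3 E4 E5 E6; exists e0, (loc phi), (loc psi); split.
- rewrite ho_shift_loc -(fun_mor_comp (loc_functor W)) E1.
  by rewrite (ho_homotopy h1 1 0) E2 (ho_homotopy h2 1 0) E3.
- rewrite ho_shift_loc -(fun_mor_comp (loc_functor W)) E4.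
  by rewrite (ho_homotopy h3 1 0) E5 (ho_homotopy h4 1 0) E6.
Qed.

End CylinderFunctor.

(** * Continuity on cylinders over realizations *)

Section ContinuityOnCylinders.
Context {R : realType} {V W : choiceType}.
Variables (K : simplicial_complex V) (L : simplicial_complex W).
Implicit Types (S : {fset V}) (x y : realization R K) (s t : R).

(** Neighbourhoods inside the product of one closed simplex with the line, where the topology is
    Euclidean and limits can be taken coordinatewise. *)
Definition simplex_nbhs S x s : set_system (realization R K * R) :=
  [set P | exists2 e : R, 0 < e & forall y t, in_closed_simplex S y ->
    (forall v, v \in S -> `|x v - y v| < e) -> `|s - t| < e -> P (y, t)].

Global Instance simplex_nbhs_filter S x s : Filter (simplex_nbhs S x s).
Proof.
split.
- by exists 1.
- move=> P Q [d d0 dP] [e e0 eQ]; exists (Num.min d e); first by rewrite lt_min d0.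
  move=> y t Sy xy st; split.
  + by apply: dP => // [v /xy|]; [rewrite lt_min => /andP[]|move: st; rewrite lt_min => /andP[]].
  + by apply: eQ => // [v /xy|]; [rewrite lt_min => /andP[]|move: st; rewrite lt_min => /andP[]].
- by move=> P Q PQ [e e0 eP]; exists e => // y t Sy xy st; apply/PQ/eP.
Qed.

Lemma simplex_nbhs_in S x s :
  \forall p \near simplex_nbhs S x s, in_closed_simplex S (p.1 : realization R K).
Proof. by exists 1. Qed.

Lemma cvg_bary S x s v : in_closed_simplex S x ->
  (fun p : realization R K * R => (p.1 : realization R K) v) @ simplex_nbhs S x s --> x v.
Proof.
move=> Sx; apply/cvgrPdist_lt => e e0; exists e => // y t Sy xy st /=.
have [vS|vS] := boolP (v \in S); first exact: xy.
by have [_ -> // _] := Sx; have [_ -> // _] := Sy; rewrite subrr normr0.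
Qed.

Lemma cvg_time S x s :
  (fun p : realization R K * R => p.2) @ simplex_nbhs S x s --> s.
Proof. by apply/cvgrPdist_lt => e e0; exists e. Qed.

Lemma near_finite {T : Type} (F : set_system T) {FF : Filter F} {I : eqType} (r : seq I)
    (P : I -> T -> Prop) :
  (forall i, i \in r -> \forall z \near F, P i z) ->
  \forall z \near F, forall i, i \in r -> P i z.
Proof.
elim: r => [|i r IH] rP; first by apply: filterE.
have h1 : \forall z \near F, P i z by apply: rP; rewrite mem_head.
have h2 : \forall z \near F, forall i, i \in r -> P i z.
  by apply: IH => k kr; apply: rP; rewrite in_cons kr orbT.
near=> z => k; rewrite in_cons => /predU1P[->|kr]; first by near: z.
by move: k kr; near: z.
Unshelve. all: by end_near.
Qed.

(** The vertex set [T] need not be a simplex of [L], so values near (x, s) may lie in different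
    faces. There are finitely many subsets of [T]. If a face contains G (x, s), openness of [U] in
    that face applies; if not, a coordinate outside it is positive at (x, s), hence nearby, and the
    face is avoided. *)
Lemma realization_open_coherent (G : realization R K * R -> realization R L) S x s
    (T : {fset W}) (U : set (realization R L)) :
  in_closed_simplex S x ->
  (forall y t w, in_closed_simplex S y -> w \notin T -> G (y, t) w = 0) ->
  (forall w, (fun p => G p w) @ simplex_nbhs S x s --> G (x, s) w) ->
  realization_open U -> U (G (x, s)) ->
  \forall p \near simplex_nbhs S x s, U (G p).
Proof.
move=> Sx GT Gw oU UG.
have faces T' : T' \in fpowerset T -> \forall p \near simplex_nbhs S x s,
    simplex L T' -> in_closed_simplex T' (G p) -> U (G p).
  move=> _; have [LT'|nLT'] := pselect (simplex L T'); last exact: filterE.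
  have [GT'|nGT'] := pselect (in_closed_simplex T' (G (x, s))).
    have [e e0 eU] := oU T' LT' _ UG GT'.
    have : \forall p \near simplex_nbhs S x s, forall w, w \in enum_fset T' ->
        `|G (x, s) w - G p w| < e.
      by apply: near_finite => w _; move/cvgrPdist_lt: (Gw w); exact.
    by apply: filterS => p pw _ pT'; exact: eU.
  have [w wT' Gw0] : exists2 w, w \notin T' & 0 < G (x, s) w.
    apply: contrapT => noW; apply: nGT'.
    have [s0 Ls0 [G0 Gs0 G1]] := baryP (G (x, s)).
    have zero w : w \notin T' -> G (x, s) w = 0.
      move=> wT'; apply/eqP; rewrite eq_le G0 andbT leNgt; apply/negP => Gw0.
      by apply: noW; exists w.
    split=> //; rewrite -G1.
    rewrite (big_fset_incl _ (fsubsetUl T' s0)) /=; last by move=> w _; exact: zero.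
    by rewrite (big_fset_incl _ (fsubsetUr T' s0)) //= => w _ /Gs0.
  have : \forall p \near simplex_nbhs S x s, 0 < G p w.
    move/cvgrPdist_lt: (Gw w) => /(_ _ Gw0); apply: filterS => p.
    by rewrite ltr_norml; lra.
  apply: filterS => p Gpw _ [_ pT' _]; by rewrite pT' // ltxx in Gpw.
have n1 := near_finite faces.
have n2 := simplex_nbhs_in S x s.
near=> p.
have Sy : in_closed_simplex S (p.1 : realization R K) by near: p.
have yU : forall T', T' \in fpowerset T ->
    simplex L T' -> in_closed_simplex T' (G p) -> U (G p) by near: p; exact: n1.
have GTp w : w \notin T -> G p w = 0 by rewrite [p]surjective_pairing; exact: GT.
have [s0 Ls0 [G0 Gs0 G1]] := baryP (G p).
have e0 : \sum_(w <- (s0 `&` T)%fset) G p w = 1.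
  rewrite -G1; apply: big_fset_incl; first exact: fsubsetIl.
  by move=> w ws0; rewrite in_fsetI ws0 /=; exact: GTp.
apply: (yU (s0 `&` T)%fset).
- by rewrite fpowersetE fsubsetIr.
- apply: simplex_face Ls0 _ _; first exact: fsubsetIl.
  by apply: contra_eq_neq e0 => ->; rewrite big_nil eq_sym oner_eq0.
- by split=> // w; rewrite in_fsetI negb_and => /orP[/Gs0 //|]; exact: GTp.
Unshelve. all: by end_near.
Qed.

(* The tube lemma makes the product of the weak topology with the line coherent with
   the products of closed simplices with the line. *)
Lemma continuous_on_cylinder (G : realization R K * R -> realization R L) :
  (forall S, simplex K S -> exists T : {fset W}, forall y t w, in_closed_simplex S y ->
     w \notin T -> G (y, t) w = 0) ->
  (forall S x s w, simplex K S -> in_closed_simplex S x ->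
     (fun p => G p w) @ simplex_nbhs S x s --> G (x, s) w) ->
  continuous G.
Proof.
move=> GT Gw; apply/continuousP => U oU; rewrite openE => -[x0 s0] Ux0.
have {}oU : realization_open U := oU.
have near_U S x s : simplex K S -> in_closed_simplex S x -> U (G (x, s)) ->
    \forall p \near simplex_nbhs S x s, U (G p).
  move=> KS Sx Us; have [T hT] := GT S KS.
  by apply: (realization_open_coherent Sx hT) => // w; exact: Gw.
have [S0 KS0 Sx0] := baryP x0.
have [d d0 dU] := near_U _ _ _ KS0 Sx0 Ux0.
pose J : set R := [set` `[s0 - d / 2, s0 + d / 2]].
(* Points over which the whole compact segment [J] is sent into [U]: compactness makes this set
   open, and A * J is the neighbourhood wanted. *)
pose A : set (realization R K) := [set x | forall s, J s -> U (G (x, s))].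
have oA : realization_open A.
  move=> S KS x Ax Sx.
  have cJ : compact J by exact: segment_compact.
  have /compact_near_coveringP/(_ R (0^'+)%R
    (fun e s => forall y, in_closed_simplex S y ->
       (forall v, v \in S -> `|x v - y v| < e) -> U (G (y, s))) _) := cJ.
  case=> [s Js|d1 /= d10 dU1]; last first.
    exists (d1 / 2); first by rewrite divr_gt0.
    move=> y Sy xy s Js; apply: (dU1 (d1 / 2)) => //=; last by rewrite divr_gt0.
    by rewrite sub0r normrN gtr0_norm ?divr_gt0 // ltr_pdivrMr // mulr2n mulrDr mulr1 ltrDl.
    have [e e0 eU] := near_U _ _ s KS Sx (Ax s Js).
    exists (ball s e, [set r | 0 < r /\ r < e]) => /=.
      split; first exact: nbhsx_ballx.
      near=> r; split; near: r; [exact: nbhs_right_gt|exact: nbhs_right_lt].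
    move=> [t r] [/= ste [r0 re]] y Sy xy; apply: eU => //.
    by move=> v vS; apply: lt_trans re; exact: xy.
have : nbhs (x0, s0) (A `*` J).
  exists (A, J) => //; split => /=.
    apply: open_nbhs_nbhs; split; first exact: oA.
    move=> s; rewrite /J /= in_itv /= => sJ; apply: dU => //.
      by move=> v _; rewrite subrr normr0.
    rewrite ltr_norml; lra.
  exists (d / 2) => /=; first by rewrite divr_gt0.
  by move=> t /=; rewrite /J /= in_itv /= ltr_distlC; lra.
apply: filterS => -[y t] /= [Ay Jt]; exact: Ay.
Unshelve. all: by end_near.
Qed.

End ContinuityOnCylinders.

(** * Maps defined on flags of simplices *)

Section FlagWeights.
Context {R : realType} {V V' V'' : choiceType}.
Variables (i : V -> V') (j : V -> V'') (q : {fset V''} -> V').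
Implicit Types (S : {fset V}) (x : V -> R) (s : R) (t : {fset V''}).

Definition push S x (v : V'') : R := \sum_(b <- S | j b == v) x b.

Definition flags S : {fset {fset V''}} := (fpowerset (j @` S) `\ fset0)%fset.

(* A point with weights [x] is the integral over the levels [l] of the superlevel sets
   [t = {v | push S x v >= l}]. At time [s] the part of the point above level [s] stays
   on the vertices [i b], while each superlevel set [t] of level below [s] is
   moved to the vertex [q t], with weight the length [flag_weight] of the interval
   of levels at which it occurs. All weights are divided by their sum. *)
Definition vertex_weight S x s b : R := Num.min (x b) (Num.max 0 (push S x (j b) - s)).

Definition flag_weight S x s t : R :=
  Num.max 0 (\big[Num.min/s]_(v <- t) push S x v
    - \big[Num.max/0]_(v <- (j @` S `\` t)%fset) push S x v).

Definition target_weight S x s w : R :=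
  \sum_(b <- S | i b == w) vertex_weight S x s b
  + \sum_(t <- flags S | q t == w) flag_weight S x s t.

Definition total_weight S x s : R :=
  \sum_(b <- S) vertex_weight S x s b + \sum_(t <- flags S) flag_weight S x s t.

Definition flag_map S x s w : R := target_weight S x s w / total_weight S x s.

Lemma fsubset_image S S' : (S `<=` S')%fset -> (j @` S `<=` j @` S')%fset.
Proof.
move=> /fsubsetP SS'; apply/fsubsetP => _ /imfsetP[b /= bS ->].
by rewrite in_imfset //; exact: SS'.
Qed.

Lemma flagsP S t : reflect ((t `<=` j @` S)%fset /\ t != fset0) (t \in flags S).
Proof.
rewrite in_fsetD1 fpowersetE; apply: (iffP andP); first by case.
by case.
Qed.

Lemma big_fset_widen {I : choiceType} (A B : {fset I}) (P : pred I) (F : I -> R) :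
  (A `<=` B)%fset -> (forall k, k \in B -> k \notin A -> P k -> F k = 0) ->
  \sum_(k <- A | P k) F k = \sum_(k <- B | P k) F k.
Proof.
move=> AB F0; rewrite big_mkcond [RHS]big_mkcond; apply: big_fset_incl => // k kB kA.
by case: ifP => // Pk; exact: F0.
Qed.

Lemma vertex_weight_ge0 S x s b : 0 <= x b -> 0 <= vertex_weight S x s b.
Proof. by move=> xb; rewrite le_min xb le_max lexx. Qed.

Lemma flag_weight_ge0 S x s t : 0 <= flag_weight S x s t.
Proof. by rewrite le_max lexx. Qed.

Lemma vertex_weight_gt0 S x s b :
  (0 < vertex_weight S x s b) = (0 < x b) && (s < push S x (j b)).
Proof. by rewrite lt_min lt_max ltxx /= subr_gt0. Qed.

Lemma flag_weight_gt0 S x s t : 0 < flag_weight S x s t ->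
  0 < s /\ (forall v, v \in (j @` S)%fset -> v \notin t ->
     push S x v < s /\ (forall u, u \in t -> push S x v < push S x u)).
Proof.
rewrite lt_max ltxx /= subr_gt0 bigmax_seq_ltE => /andP[m0 /allP mM].
split=> [|v vS vt]; first exact: lt_le_trans m0 (bigmin_le_id _ _ _ _).
have vSt : v \in (j @` S `\` t)%fset by rewrite in_fsetD vt.
split=> [|u ut]; first exact: lt_le_trans (mM v vSt) (bigmin_le_id _ _ _ _).
exact: lt_le_trans (mM v vSt) (@ge_bigmin_seq _ _ _ t s u xpredT (push S x) ut isT).
Qed.

(** Sets of positive weight are superlevel sets of one function, hence form a chain. *)
Lemma flag_weight_nested S x s s' t t' : t \in flags S -> t' \in flags S ->
  0 < flag_weight S x s t -> 0 < flag_weight S x s' t' ->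
  (t `<=` t')%fset \/ (t' `<=` t)%fset.
Proof.
move=> /flagsP[tS _] /flagsP[t'S _] /flag_weight_gt0[_ ht] /flag_weight_gt0[_ ht'].
have [|/fsubsetPn[v vt vt']] := boolP (t `<=` t')%fset; first by left.
right; apply/fsubsetP => u ut'; apply: contraT => ut.
have [_ /(_ v vt)] := ht u (fsubsetP t'S u ut') ut.
have [_ /(_ u ut')] := ht' v (fsubsetP tS v vt) vt'.
by move=> /lt_trans/[apply]; rewrite ltxx.
Qed.

(** A vertex still in place lies over a level above [s], whereas everything outside [t] lies below
    [s]. *)
Lemma vertex_in_flag S x s t b : b \in S -> 0 < vertex_weight S x s b ->
  0 < flag_weight S x s t -> j b \in t.
Proof.
move=> bS; rewrite vertex_weight_gt0 => /andP[_ sb] /flag_weight_gt0[_ ht].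
apply: contraT => bt; have [] := ht (j b) _ bt; first exact: in_imfset.
by move=> /(lt_trans sb); rewrite ltxx.
Qed.

Section OnSimplex.
Variables (S : {fset V}) (x : V -> R).
Hypothesis Sx : in_closed_simplex S x.

Lemma push_ge0 v : 0 <= push S x v.
Proof. by have [x0 _ _] := Sx; apply: sumr_ge0. Qed.

Lemma push_le1 v : push S x v <= 1.
Proof.
have [x0 _ <-] := Sx; rewrite [leRHS](bigID (fun b => j b == v)) /= lerDl.
exact: sumr_ge0.
Qed.

Lemma push_notin v : v \notin (j @` S)%fset -> push S x v = 0.
Proof.
move=> vS; rewrite /push big_seq_cond big1 // => b /andP[bS /eqP bv].
by rewrite -bv in_imfset in vS.
Qed.

Lemma push_ge b : b \in S -> x b <= push S x (j b).
Proof.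
move=> bS; have [x0 _ _] := Sx.
rewrite /push big_mkcond (big_fsetD1 _ bS) /= eqxx lerDl.
by apply: sumr_ge0 => c _; case: ifP.
Qed.

(** The weights are insensitive to enlarging the simplex around [x], because new vertices have
    coordinate 0. This underlies both the independence of the carrier and strict naturality. *)
Lemma push_widen S' v : (S `<=` S')%fset -> push S' x v = push S x v.
Proof.
move=> SS'; have [_ x0 _] := Sx.
by apply/esym/big_fset_widen => // b _ bS _; exact: x0.
Qed.

Lemma vertex_weight_widen S' s b : (S `<=` S')%fset ->
  vertex_weight S' x s b = vertex_weight S x s b.
Proof. by move=> SS'; rewrite /vertex_weight push_widen. Qed.

Lemma vertex_weight_notin s b : b \notin S -> vertex_weight S x s b = 0.
Proof.
move=> bS; have [_ x0 _] := Sx; rewrite /vertex_weight x0 //.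
by apply/min_idPl; rewrite le_max lexx.
Qed.

Lemma flag_weight_widen S' s t : (S `<=` S')%fset ->
  flag_weight S' x s t = flag_weight S x s t.
Proof.
move=> SS'; rewrite /flag_weight; congr (Num.max 0 (_ - _)).
  by apply: eq_bigr => v _; exact: push_widen.
apply/le_anti/andP; split; rewrite bigmax_seq_leE bigmax_ge_id; apply/allP => v.
- rewrite in_fsetD => /andP[vt vS']; rewrite push_widen //.
  have [vS|vS] := boolP (v \in (j @` S)%fset); last by rewrite push_notin // bigmax_ge_id.
  apply: (@le_bigmax_seq _ _ _ (j @` S `\` t)%fset 0 v xpredT (push S x)) => //.
  by rewrite in_fsetD vt.
- rewrite in_fsetD => /andP[vt /imfsetP[b /= bS vb]]; rewrite -(push_widen _ SS').
  apply: (@le_bigmax_seq _ _ _ (j @` S' `\` t)%fset 0 v xpredT (push S' x)) => //.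
  by rewrite in_fsetD vt vb in_imfset //; exact: (fsubsetP SS').
Qed.

Lemma flag_weight_notin s t : ~~ (t `<=` j @` S)%fset -> flag_weight S x s t = 0.
Proof.
move=> /fsubsetPn[v vt vS]; apply/eqP; rewrite eq_le flag_weight_ge0 andbT.
rewrite ge_max lexx subr_le0; apply: le_trans (bigmax_ge_id _ _ _ _).
by rewrite -(push_notin vS); exact: ge_bigmin_seq.
Qed.

Lemma target_weight_widen S' s w : (S `<=` S')%fset ->
  target_weight S' x s w = target_weight S x s w.
Proof.
move=> SS'; rewrite /target_weight; congr (_ + _); apply/esym.
- under eq_bigr do rewrite -(vertex_weight_widen _ _ SS').
  apply: big_fset_widen => // b _ bS _.
  by rewrite vertex_weight_widen // vertex_weight_notin.
- under eq_bigr do rewrite -(flag_weight_widen _ _ SS').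
  apply: big_fset_widen => [|t /flagsP[tS' t0] /flagsP tS _].
    apply/fsubsetP => t /flagsP[tS t0]; apply/flagsP; split=> //.
    by apply: (fsubset_trans tS); exact: fsubset_image.
  rewrite flag_weight_widen // flag_weight_notin //.
  by apply/negP => tS1; apply: tS.
Qed.

Lemma total_weight_widen S' s : (S `<=` S')%fset ->
  total_weight S' x s = total_weight S x s.
Proof.
move=> SS'; rewrite /total_weight; congr (_ + _); apply/esym.
- under eq_bigr do rewrite -(vertex_weight_widen _ _ SS').
  apply: big_fset_widen => // b _ bS _.
  by rewrite vertex_weight_widen // vertex_weight_notin.
- under eq_bigr do rewrite -(flag_weight_widen _ _ SS').
  apply: big_fset_widen => [|t /flagsP[tS' t0] /flagsP tS _].
    apply/fsubsetP => t /flagsP[tS t0]; apply/flagsP; split=> //.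
    by apply: (fsubset_trans tS); exact: fsubset_image.
  rewrite flag_weight_widen // flag_weight_notin //.
  by apply/negP => tS1; apply: tS.
Qed.

(** For s <= 0 a vertex with positive coordinate keeps weight; for s > 0 the superlevel set of the
    lowest levels, where the pushed weight is positive, has received some. *)
Lemma total_weight_gt0 s : 0 < total_weight S x s.
Proof.
have [x0 xS x1] := Sx.
have vge0 : 0 <= \sum_(b <- S) vertex_weight S x s b.
  by apply: sumr_ge0 => b _; exact: vertex_weight_ge0.
have fge0 : 0 <= \sum_(t <- flags S) flag_weight S x s t.
  by apply: sumr_ge0 => t _; exact: flag_weight_ge0.
have [b bS xb] : exists2 b, b \in S & 0 < x b.
  apply: contrapT => nob; have : \sum_(b <- S) x b = 0.
    rewrite big_seq_cond big1 // => b /andP[bS _]; apply/eqP; rewrite eq_le x0 andbT leNgt.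
    by apply/negP => xb; apply: nob; exists b.
  by rewrite x1; apply/eqP; exact: oner_neq0.
have pb : 0 < push S x (j b) by exact: lt_le_trans xb (push_ge bS).
have [s0|s0] := lerP s 0.
  apply: ltr_pwDl => //; rewrite (big_fsetD1 _ bS) /=.
  apply: ltr_pwDl; first by rewrite vertex_weight_gt0 xb (le_lt_trans s0).
  by apply: sumr_ge0 => d _; exact: vertex_weight_ge0.
pose t := [fset v in (j @` S)%fset | 0 < push S x v]%fset.
have tS : t \in flags S.
  apply/flagsP; split; first exact: fset_sub.
  by apply/fset0Pn; exists (j b); rewrite !inE /= in_imfset.
apply: ltr_wpDl => //; rewrite (big_fsetD1 _ tS) /=.
apply: ltr_pwDl; last by apply: sumr_ge0 => d _; exact: flag_weight_ge0.
rewrite lt_max ltxx /= subr_gt0; apply: (@le_lt_trans _ _ 0).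
  rewrite bigmax_seq_leE lexx; apply/allP => v; rewrite !inE /= => /andP[vt vS].
  by move: vt; rewrite vS /= -leNgt.
rewrite bigmin_seq_ltE s0; apply/allP => v; rewrite !inE /= => /andP[_]; exact.
Qed.
End OnSimplex.
End FlagWeights.

Section MinMaxLimits.
Context {R : realType} {T : Type} (F : set_system T) {FF : Filter F}.
Implicit Types (f g : T -> R) (a b : R).

Lemma continuous_max_pair : continuous ((fun z : R * R => Num.max z.1 z.2) : R * R -> R).
Proof.
move=> z; apply: (@continuous_max R (R * R)%type fst snd z); [exact: cvg_fst|exact: cvg_snd].
Qed.

Lemma continuous_min_pair : continuous ((fun z : R * R => Num.min z.1 z.2) : R * R -> R).
Proof.
have -> : (fun z : R * R => Num.min z.1 z.2) =
    (fun z : R * R => z.1 + z.2 - Num.max z.1 z.2).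
  by apply/funext => z; rewrite -(addr_max_min z.1 z.2) addrAC subrr add0r.
move=> z; apply: cvgB; last exact: continuous_max_pair.
by apply: cvgD; [exact: cvg_fst|exact: cvg_snd].
Qed.

Lemma cvg_max f g a b : f @ F --> a -> g @ F --> b ->
  ((fun z => Num.max (f z) (g z)) : T -> R) @ F --> (Num.max a b : R).
Proof.
move=> fa gb.
exact: (cvg_comp _ _ (cvg_pair fa gb) (@continuous_max_pair (a, b))).
Qed.

Lemma cvg_min f g a b : f @ F --> a -> g @ F --> b ->
  ((fun z => Num.min (f z) (g z)) : T -> R) @ F --> (Num.min a b : R).
Proof.
move=> fa gb.
exact: (cvg_comp _ _ (cvg_pair fa gb) (@continuous_min_pair (a, b))).
Qed.

Lemma cvg_sum_seq {I : Type} (r : seq I) (P : pred I) (f : I -> T -> R) (a : I -> R) :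
  (forall k, f k @ F --> a k) ->
  (fun z => \sum_(k <- r | P k) f k z) @ F --> \sum_(k <- r | P k) a k.
Proof. by move=> fa; apply: cvg_big => // z; exact: add_continuous. Qed.

Lemma cvg_bigmax_seq {I : Type} (r : seq I) (f : I -> T -> R) (a : I -> R) c :
  (forall k, f k @ F --> a k) ->
  (fun z => \big[Num.max/c]_(k <- r) f k z) @ F --> \big[Num.max/c]_(k <- r) a k.
Proof. by move=> fa; apply: cvg_big => //; exact: continuous_max_pair. Qed.

Lemma cvg_bigmin_seq {I : Type} (r : seq I) (f : I -> T -> R) (a : I -> R) h c :
  (forall k, f k @ F --> a k) -> h @ F --> c ->
  (fun z => \big[Num.min/h z]_(k <- r) f k z) @ F --> \big[Num.min/c]_(k <- r) a k.
Proof.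
move=> fa hc; elim: r => [|k r IH].
  by rewrite big_nil; under eq_fun do rewrite big_nil.
by rewrite big_cons; under eq_fun do rewrite big_cons; exact: cvg_min.
Qed.

End MinMaxLimits.

Section FlagMap.
Context {R : realType} {V V'' : choiceType} {X : metricType R}.
Variables (i : V -> X) (j : V -> V'') (q : {fset V''} -> X).
Implicit Types (S : {fset V}) (s : R) (t : {fset V''}) (w : X).

Lemma sum_fibers {I V' : choiceType} (A : {fset I}) (T : {fset V'}) (g : I -> V')
    (F : I -> R) : (forall k, k \in A -> g k \in T) ->
  \sum_(w <- T) \sum_(k <- A | g k == w) F k = \sum_(k <- A) F k.
Proof.
move=> gT; under eq_bigr do rewrite big_mkcond.
rewrite exchange_big /=; apply: eq_big_seq => k kA.
rewrite (big_fsetD1 (g k)) /= ?gT // eqxx big_seq_cond big1 ?addr0 //.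
by move=> w /andP[]; rewrite in_fsetD1 eq_sym => /andP[/negPf->].
Qed.

(** Only the vertices of positive weight are kept: all images together need not span a simplex of
    the target. *)
Lemma flag_map_simplex S (x : V -> R) s : in_closed_simplex S x ->
  in_closed_simplex [fset w in (i @` S `|` q @` flags j S)%fset |
    0 < flag_map i j q S x s w]%fset (flag_map i j q S x s).
Proof.
move=> Sx; have tot0 := total_weight_gt0 j Sx s.
have [x0 _ _] := Sx.
have tw0 w : 0 <= target_weight i j q S x s w.
  rewrite addr_ge0 // sumr_ge0 // => k _; first exact: vertex_weight_ge0.
  exact: flag_weight_ge0.
have fm0 w : 0 <= flag_map i j q S x s w by rewrite divr_ge0 // ltW.
set T0 := (i @` S `|` q @` flags j S)%fset.
have out w : w \notin T0 -> flag_map i j q S x s w = 0.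
  rewrite in_fsetU negb_or => /andP[wi wq].
  rewrite /flag_map /target_weight [X in X + _]big_seq_cond [X in _ + X]big_seq_cond.
  rewrite !big1 ?addr0 ?mul0r //.
    by move=> t /andP[tS /eqP tw]; rewrite -tw in_imfset in wq.
  by move=> b /andP[bS /eqP bw]; rewrite -bw in_imfset in wi.
have neg w : ~~ (0 < flag_map i j q S x s w) -> flag_map i j q S x s w = 0.
  by rewrite -leNgt => h; apply/eqP; rewrite eq_le h fm0.
have iT b : b \in S -> i b \in T0 by move=> bS; rewrite in_fsetU in_imfset.
have qT t : t \in flags j S -> q t \in T0 by move=> tS; rewrite in_fsetU in_imfset ?orbT.
clearbody T0; split=> // [w|].
  by rewrite !inE /= negb_and => /orP[/out|/neg].
rewrite (big_fset_incl _ (fset_sub _ _)) /=; last first.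
  by move=> w wT; rewrite !inE /= wT /= => /neg.
by rewrite -mulr_suml big_split /= !sum_fibers // divff // lt0r_neq0.
Qed.

(* If [act] is false the deformation is frozen at time 1, where the vertices [i b]
   carry no weight. *)
Definition flag_compatible (act : bool) (K : simplicial_complex V) (delta : R)
    (A : set X) : Prop :=
  [/\ forall S t, simplex K S -> t \in flags j S -> A (q t),
      forall S t t', simplex K S -> t \in flags j S -> t' \in flags j S ->
        (t `<=` t')%fset -> mdist (q t) (q t') < delta,
      act -> forall S b, simplex K S -> b \in S -> A (i b),
      act -> forall S b b', simplex K S -> b \in S -> b' \in S -> mdist (i b) (i b') < delta &
      act -> forall S b t, simplex K S -> b \in S -> t \in flags j S -> j b \in t ->
        mdist (i b) (q t) < delta].

Definition flag_time (act : bool) s : R := if act then s else 1.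

(** The least carrier of the point, contained in all others whatever simplex is chosen here. *)
Definition supp {K : simplicial_complex V} (x : realization R K) : {fset V} :=
  [fset v in projT1 (cid2 (baryP x)) | x v != 0]%fset.

Lemma suppP (K : simplicial_complex V) (x : realization R K) :
  simplex K (supp x) /\ in_closed_simplex (supp x) x.
Proof.
rewrite /supp; case: cid2 => S KS [x0 xS x1] /=.
have sx : in_closed_simplex [fset v in S | x v != 0]%fset x.
  split=> // [v|].
    by rewrite !inE /= negb_and negbK => /orP[/xS|/eqP].
  rewrite -x1; apply: big_fset_incl; first exact: fset_sub.
  by move=> v vS; rewrite !inE /= vS negbK => /eqP.
split=> //; apply: (simplex_face KS); first exact: fset_sub.
by have [_ _] := sx; apply: contra_eq_neq => ->; rewrite big_nil eq_sym oner_eq0.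
Qed.

Lemma supp_sub (K : simplicial_complex V) (x : realization R K) S :
  in_closed_simplex S x -> (supp x `<=` S)%fset.
Proof.
move=> [_ xS _]; apply/fsubsetP => v; rewrite !inE /= => /andP[_].
by apply: contraR => /xS ->.
Qed.

Section Points.
Variables (act : bool) (K : simplicial_complex V) (delta : R) (A : set X).
Hypothesis compat : flag_compatible act K delta A.

(** Two vertices of positive weight are two unmoved vertices, an unmoved vertex and a flag member
    containing its image, or two nested members: the pairs controlled by [flag_compatible]. *)
Lemma flag_map_in_rips (x : realization R K) s :
  exists2 T, simplex (rips delta A) T &
    in_closed_simplex T (flag_map i j q (supp x) x (flag_time act s)).
Proof.
have [KS Sx] := suppP x; set S := supp x in KS Sx *.
have fs := flag_map_simplex (flag_time act s) Sx; have [_ _ f1] := fs.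
have [x0 _ _] := Sx.
exists [fset w in (i @` S `|` q @` flags j S)%fset |
    0 < flag_map i j q S x (flag_time act s) w]%fset; last exact: fs.
have [Aq dqq Ai dii diq] := compat.
have pos w : w \in [fset w in (i @` S `|` q @` flags j S)%fset |
      0 < flag_map i j q S x (flag_time act s) w]%fset ->
    (act /\ exists2 b, i b = w & b \in S /\ 0 < vertex_weight j S x (flag_time act s) b) \/
    (exists2 t, q t = w & t \in flags j S /\ 0 < flag_weight j S x (flag_time act s) t).
  rewrite !inE /= => /andP[_]; rewrite pmulr_lgt0 ?invr_gt0 ?total_weight_gt0 // => tw.
  apply: contrapT => none; move: tw; rewrite /target_weight [X in X + _]big_seq_cond [X in _ + X]big_seq_cond !big1 ?addr0 ?ltxx //.
    move=> t /andP[tS /eqP tw]; apply/eqP; rewrite eq_le flag_weight_ge0 andbT leNgt.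
    by apply/negP => t0; apply: none; right; exists t.
  move=> b /andP[bS /eqP bw]; apply/eqP; rewrite eq_le vertex_weight_ge0 // andbT leNgt.
  apply/negP => b0; apply: none; left; split; last by exists b.
  move: b0; rewrite vertex_weight_gt0 /flag_time; case: act => // /andP[_].
  by rewrite ltNge push_le1.
split.
- by apply: contra_eq_neq f1 => ->; rewrite big_nil eq_sym oner_eq0.
- move=> w /pos [[a [b <- [bS _]]]|[t <- [tS _]]]; [exact: (Ai a S)|exact: (Aq S)].
- move=> w w' /pos [[a [b <- [bS b0]]]|[t <- [tS t0]]] /pos
    [[a' [b' <- [bS' b0']]]|[t' <- [tS' t0']]].
  + exact: (dii a S).
  + by apply: (diq a S) => //; exact: vertex_in_flag b0 t0'.
  + by rewrite metric_sym; apply: (diq a' S) => //; exact: vertex_in_flag b0' t0.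
  + have [tt'|tt'] := flag_weight_nested tS tS' t0 t0'; first exact: (dqq S).
    by rewrite metric_sym; exact: (dqq S).
Qed.

Definition flag_point (z : realization R K * R) : realization R (rips delta A) :=
  RealizationPoint (flag_map_in_rips z.1 z.2).

Lemma flag_pointE S x s w : in_closed_simplex S (bary x) ->
  flag_point (x, s) w = flag_map i j q S x (flag_time act s) w.
Proof.
move=> Sx; rewrite /= /flag_map.
have [_ sx] := suppP x; have sub := supp_sub Sx.
by rewrite -(target_weight_widen i j q sx _ _ sub) -(total_weight_widen j sx _ sub).
Qed.

Lemma continuous_flag_point : continuous flag_point.
Proof.
apply: continuous_on_cylinder => [S KS|S x s w KS Sx].
  exists (i @` S `|` q @` flags j S)%fset => y r w Sy wT.
  rewrite (flag_pointE _ _ Sy); have [_ out _] := flag_map_simplex (flag_time act r) Sy.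
  by apply: out; apply: contra wT; exact: (fsubsetP (fset_sub _ _)).
rewrite (flag_pointE _ _ Sx).
pose G (p : realization R K * R) := flag_map i j q S p.1 (flag_time act p.2) w.
apply: (@cvg_trans _ (G @ simplex_nbhs S x s)).
  apply: near_eq_cvg; apply: filterS (simplex_nbhs_in S x s) => -[y r] Sy.
  by rewrite (flag_pointE _ _ Sy).
have ct : (fun p : realization R K * R => flag_time act p.2) @ simplex_nbhs S x s -->
    flag_time act s.
  by rewrite /flag_time; case: act; [exact: cvg_time|exact: cvg_cst].
have cp v : (fun p : realization R K * R => push j S p.1 v) @ simplex_nbhs S x s -->
    push j S x v.
  by apply: cvg_sum_seq => b; exact: cvg_bary.
have cv b : (fun p : realization R K * R => vertex_weight j S p.1 (flag_time act p.2) b)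
    @ simplex_nbhs S x s --> vertex_weight j S x (flag_time act s) b.
  apply: cvg_min; first exact: cvg_bary.
  by apply: cvg_max; [exact: cvg_cst|apply: cvgB].
have cf t : (fun p : realization R K * R => flag_weight j S p.1 (flag_time act p.2) t)
    @ simplex_nbhs S x s --> flag_weight j S x (flag_time act s) t.
  apply: cvg_max; first exact: cvg_cst.
  by apply: cvgB; [exact: cvg_bigmin_seq|exact: cvg_bigmax_seq].
apply: cvgM; first by apply: cvgD; exact: cvg_sum_seq.
apply: cvgV; first by rewrite lt0r_neq0 // total_weight_gt0.
by apply: cvgD; exact: cvg_sum_seq.
Qed.

End Points.
End FlagMap.

Section FlagMapEndpoints.
Context {R : realType} {V V'' : choiceType} {V' : choiceType}.
Variables (j : V -> V'').
Implicit Types (S : {fset V}) (x : V -> R) (i : V -> V') (q : {fset V''} -> V') (w : V').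

Lemma flag_map_time0 i q S x w : in_closed_simplex S x ->
  flag_map i j q S x 0 w = \sum_(b <- S | i b == w) x b.
Proof.
move=> Sx; have [x0 xS x1] := Sx.
have v0 b : b \in S -> vertex_weight j S x 0 b = x b.
  move=> bS; rewrite /vertex_weight subr0; apply/min_idPl.
  by rewrite le_max (push_ge j Sx bS) orbT.
have f0 t : flag_weight j S x 0 t = 0.
  apply/eqP; rewrite eq_le flag_weight_ge0 andbT ge_max lexx subr_le0.
  exact: le_trans (bigmin_le_id _ _ _ _) (bigmax_ge_id _ _ _ _).
rewrite /flag_map /target_weight /total_weight.
rewrite [X in (_ + X) / _]big1 // [X in _ / (_ + X)]big1 // !addr0.
rewrite [X in _ / X](eq_big_seq x) // x1 divr1.
by rewrite big_seq_cond [RHS]big_seq_cond; apply: eq_bigr => b /andP[bS _]; exact: v0.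
Qed.

Lemma vertex_weight_time1 S x b : in_closed_simplex S x -> vertex_weight j S x 1 b = 0.
Proof.
move=> Sx; have [x0 _ _] := Sx; apply/eqP; rewrite eq_le vertex_weight_ge0 // andbT leNgt.
by rewrite vertex_weight_gt0 negb_and -leNgt -leNgt (push_le1 j Sx) orbT.
Qed.

Lemma flag_map_time1 i q S x w : in_closed_simplex S x ->
  flag_map i j q S x 1 w = (\sum_(t <- flags j S | q t == w) flag_weight j S x 1 t) /
    \sum_(t <- flags j S) flag_weight j S x 1 t.
Proof.
move=> Sx; rewrite /flag_map /target_weight /total_weight.
rewrite [X in (X + _) / _]big1 => [|b _]; last exact: vertex_weight_time1.
rewrite [X in _ / (X + _)]big1 => [|b _]; last exact: vertex_weight_time1.
by rewrite !add0r.
Qed.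

End FlagMapEndpoints.

(** At time 1 all weight sits on the points [q t], so a simplicial map applied afterwards merely
    changes [q]. *)
Lemma flag_map_push {R : realType} {V V'' : choiceType} {X Y : metricType R}
    (j : V -> V'') (i : V -> X) (i' : V -> Y) (c : X -> Y) (q : {fset V''} -> X)
    (S : {fset V}) (x : V -> R) (T : {fset X}) w :
  in_closed_simplex S x -> in_closed_simplex T (flag_map i j q S x 1) ->
  push c T (flag_map i j q S x 1) w = flag_map i' j (c \o q) S x 1 w.
Proof.
move=> Sx Tx; have [_ Tout _] := Tx.
rewrite flag_map_time1 // /push.
set T' := (T `|` q @` flags j S)%fset.
rewrite (@big_fset_widen _ _ T T') //; first last.
- by move=> k _ kT _; exact: Tout.
- exact: fsubsetUl.
under eq_bigr do rewrite flag_map_time1 //.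
rewrite -mulr_suml; congr (_ / _).
rewrite big_mkcond /= [RHS]big_mkcond /=.
rewrite -(@sum_fibers _ _ _ (flags j S) T' q); last first.
  by move=> t tS; rewrite !inE in_imfset // orbT.
apply: eq_bigr => b _; case: ifP => [/eqP cb|cb].
  by apply: eq_bigr => t /eqP tb; rewrite /= tb cb eqxx.
by rewrite big1 // => t /eqP tb; rewrite /= tb cb.
Qed.

Lemma push_simplex {R : realType} {V V' : choiceType} (c : V -> V')
    (S : {fset V}) (x : V -> R) : in_closed_simplex S x ->
  in_closed_simplex (c @` S)%fset (push c S x).
Proof.
move=> Sx; split; [exact: push_ge0 Sx|by move=> v; exact: push_notin|].
have [_ _ <-] := Sx; apply: sum_fibers => k kS; exact: in_imfset.
Qed.

Lemma push_id {R : realType} {V : choiceType} (S : {fset V}) (x : V -> R) w :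
  in_closed_simplex S x -> push id S x w = x w.
Proof.
move=> [_ xS _]; rewrite /push big_mkcond /=.
have [wS|wS] := boolP (w \in S).
  rewrite (big_fsetD1 w) //= eqxx big_seq_cond big1 ?addr0 // => b.
  by rewrite in_fsetD1 andbT => /andP[/negPf->].
rewrite big_seq_cond big1 ?xS // => b; rewrite andbT => bS.
by case: eqP => // bw; rewrite -bw bS in wS.
Qed.

(** A simplicial map applied beforehand is absorbed into the parameter [j], since superlevel sets
    are those of the pushed weights. *)
Lemma flag_map_pushforward {R : realType} {V V' V'' : choiceType} (c : V -> V')
    (i : V -> V'') (i' : V' -> V'') (q : {fset V'} -> V'') (S : {fset V}) (x : V -> R) w :
  in_closed_simplex S x ->
  flag_map i c q S x 1 w = flag_map i' id q (c @` S)%fset (push c S x) 1 w.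
Proof.
move=> Sx; have Px := push_simplex c Sx.
rewrite (flag_map_time1 c) // (flag_map_time1 id) //.
have fl : flags id (c @` S)%fset = flags c S.
  by rewrite /flags; congr (fpowerset _ `\ _)%fset; apply/fsetP => v; rewrite imfset_id.
have pid v := push_id v Px.
have fw t : flag_weight id (c @` S)%fset (push c S x) 1 t = flag_weight c S x 1 t.
  rewrite /flag_weight; congr (Num.max 0 (_ - _)).
    by apply: eq_bigr => v _; exact: pid.
  by rewrite imfset_id; apply: eq_bigr => v _; exact: pid.
by rewrite fl; congr (_ / _); apply: eq_bigr => t _; rewrite fw.
Qed.

(** * Flag maps as morphisms of persistent spaces *)

Section FlagTransformations.
Context {R : realType} {N : nat}.

Section OneStage.
Context {V'' : choiceType} {X0 X2 : metricType R}.
Variables (d0 d2 e : R) (g0 : X0 -> 'rV[R]_N) (g2 : X2 -> 'rV[R]_N).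
Variables (i : X0 -> X2) (j : X0 -> V'') (q : {fset V''} -> X2) (act : bool).

Lemma flag_point_natural (K K' : simplicial_complex X0) (A A' : set X2)
    (KK' : simplex K `<=` simplex K') (AA' : simplex (rips d2 A) `<=` simplex (rips d2 A'))
    (c : flag_compatible i j q act K d2 A) (c' : flag_compatible i j q act K' d2 A')
    (x : realization R K) (s : R) :
  flag_point c' (realization_incl KK' x, s) = realization_incl AA' (flag_point c (x, s)).
Proof.
apply: realization_eq => w; have [_ Sx] := suppP x.
by rewrite (flag_pointE c' (S := supp x)).
Qed.

Definition flag_transformation
    (c : forall u, flag_compatible i j q act (rips d0 (sublevel g0 u)) d2
           (sublevel g2 (u + const_mx e))) :
  nat_trans (cylinder (rips_filtration d0 g0)) (pshift N e (rips_filtration d2 g2)).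
Proof.
exists (fun u => [the continuousType _ _ of mkcts (continuous_flag_point (compat := c u))] :
  @mor Top (cylinder (rips_filtration d0 g0) u) (pshift N e (rips_filtration d2 g2) u)).
move=> u v uv; apply/continuousEP => -[x s].
exact: flag_point_natural.
Defined.

Definition flag_transformation2
    (c : forall u, flag_compatible i j q act (rips d0 (sublevel g0 u)) d2
           (sublevel g2 (u + const_mx e + const_mx e))) :
  nat_trans (cylinder (rips_filtration d0 g0))
    (pshift N e (pshift N e (rips_filtration d2 g2))).
Proof.
exists (fun u => [the continuousType _ _ of mkcts (continuous_flag_point (compat := c u))] :
  @mor Top (cylinder (rips_filtration d0 g0) u)
    (pshift N e (pshift N e (rips_filtration d2 g2)) u)).
move=> u v uv; apply/continuousEP => -[x s].
exact: flag_point_natural.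
Defined.

End OneStage.

Section TwoStages.
Context {V1 V2 : choiceType} {X0 X1 X2 : metricType R}.
Variables (d0 d1 d2 a e : R).
Variables (g0 : X0 -> 'rV[R]_N) (g1 : X1 -> 'rV[R]_N) (g2 : X2 -> 'rV[R]_N).
Variables (i1 : X0 -> X1) (j1 : X0 -> V1) (q1 : {fset V1} -> X1).
Variables (i2 : X1 -> X2) (j2 : X1 -> V2) (q2 : {fset V2} -> X2) (act : bool).
Hypothesis c1 : forall u, flag_compatible i1 j1 q1 false (rips d0 (sublevel g0 u)) d1
  (sublevel g1 (u + const_mx a)).
Hypothesis c2 : forall u, flag_compatible i2 j2 q2 act
  (rips d1 (sublevel g1 (u + const_mx a))) d2 (sublevel g2 (u + const_mx e + const_mx e)).

Lemma continuous_two_stages u :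
  continuous (fun z : realization R (rips d0 (sublevel g0 u)) * R =>
    flag_point (c2 u) (flag_point (c1 u) (z.1, 0), z.2)).
Proof.
pose f (z : realization R (rips d0 (sublevel g0 u)) * R) := (flag_point (c1 u) (z.1, 0), z.2).
have cf : continuous f.
  move=> z; have h1 : {for z, continuous (fun z : realization R (rips d0 (sublevel g0 u)) * R =>
      flag_point (c1 u) (z.1, 0))}.
    apply: (@continuous_comp _ _ _ (fun z : realization R (rips d0 (sublevel g0 u)) * R =>
      (z.1, 0 : R)) (flag_point (c1 u))).
      apply: (@continuous_comp _ _ _ (fst : realization R (rips d0 (sublevel g0 u)) * R -> _)
        (fun x => (x, 0 : R))); first exact: cvg_fst.
      exact: cylinder_section_continuous.
    exact: continuous_flag_point.
  have h2 : {for z, continuous (snd : realization R (rips d0 (sublevel g0 u)) * R -> R)}.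
    exact: cvg_snd.
  exact: (cvg_pair h1 h2).
move=> z; apply: (@continuous_comp _ _ _ f (flag_point (c2 u))); first exact: cf.
exact: continuous_flag_point.
Qed.

(** Only the second stage moves; the first is frozen, its time argument 0 being read as 1. The
    intermediate shift [a] is separate from [e] because a contraction inside M raises levels by less
    than an exchange of spaces. *)
Definition two_stage_transformation :
  nat_trans (cylinder (rips_filtration d0 g0))
    (pshift N e (pshift N e (rips_filtration d2 g2))).
Proof.
exists (fun u => [the continuousType _ _ of mkcts (@continuous_two_stages u)] :
  @mor Top (cylinder (rips_filtration d0 g0) u)
    (pshift N e (pshift N e (rips_filtration d2 g2)) u)).
move=> u v uv; apply/continuousEP => -[x s] /=.
rewrite /mkcts /=.
rewrite (flag_point_natural _ (rips_sublevel (delta := d1) (g := g1)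
  (lev_add2r (const_mx a) uv)) (c1 u)).
exact: flag_point_natural.
Defined.

End TwoStages.
End FlagTransformations.

Lemma row_norm_coord {R : realType} {N : nat} (x y : 'rV[R]_N) z k :
  `|x - y| <= z -> y 0 k <= x 0 k + z.
Proof.
move=> xyz; have : `|(x - y) 0 k| <= z.
  have : mx_norm (x - y) <= z := xyz.
  rewrite mx_normrE; apply: le_trans.
  exact: (le_bigmax 0 (fun ij => `|(x - y) ij.1 ij.2|) (0, k)).
by rewrite !mxE ler_norml; lra.
Qed.

Lemma sublevel_coord {R : realType} {N : nat} {X : metricType R} (f : X -> 'rV[R]_N) u x k :
  sublevel f u x -> f x 0 k <= u 0 k.
Proof. by move=> /forallP. Qed.

(** * The interleaving *)

Section Interleaving.
Context {R : realType} {N : nat} {X Y : metricType R}.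
Variables (f : X -> 'rV[R]_N) (g : Y -> 'rV[R]_N).
Variables (c' : X -> Y) (c : Y -> X) (p : {fset Y} -> Y) (delta eps a e_fun : R).
Hypotheses (eps0 : 0 <= eps) (a0 : 0 <= a) (e_fun0 : 0 <= e_fun).
Hypothesis dist_c' : forall x y, mdist (c' x) (c' y) <= mdist x y + eps.
Hypothesis dist_c : forall x y, mdist (c x) (c y) <= mdist x y + eps.
Hypothesis dist_mixed : forall x y, mdist x (c y) <= mdist (c' x) y + eps.
Hypothesis dist_back : forall x y, mdist x y <= mdist (c' (c x)) y + eps.
Hypothesis level_c' : forall x k, g (c' x) 0 k <= f x 0 k + e_fun.
Hypothesis level_c : forall y k, f (c y) 0 k <= g y 0 k + e_fun.
Hypothesis p_level : forall (t : {fset Y}) z k, t != fset0 ->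
  (forall x y, x \in t -> y \in t -> mdist x y < delta + eps) ->
  (forall x, x \in t -> g x 0 k <= z) -> g (p t) 0 k <= z + a.
Hypothesis p_near : forall (t : {fset Y}) b, b \in t ->
  (forall x y, x \in t -> y \in t -> mdist x y < delta + eps) ->
  mdist b (p t) < delta - eps.
Hypothesis p_chain : forall t t' : {fset Y}, t != fset0 -> (t `<=` t')%fset ->
  (forall x y, x \in t' -> y \in t' -> mdist x y < delta + eps) ->
  mdist (p t) (p t') < delta - eps.

Let e := a + e_fun.
Implicit Types (u v : 'rV[R]_N) (d : R).

Lemma image_neq0 (V : choiceType) (h : V -> Y) (t : {fset V}) :
  t != fset0 -> (h @` t)%fset != fset0.
Proof. by move=> /fset0Pn[x xt]; apply/fset0Pn; exists (h x); exact: in_imfset. Qed.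

Lemma image_c'_diam (t : {fset X}) :
  (forall x y, x \in t -> y \in t -> mdist x y < delta) ->
  forall x y, x \in (c' @` t)%fset -> y \in (c' @` t)%fset -> mdist x y < delta + eps.
Proof.
move=> td _ _ /imfsetP[x /= xt ->] /imfsetP[y /= yt ->].
by apply: le_lt_trans (dist_c' x y) _; rewrite ltrD2r td.
Qed.

Lemma image_c'_level (t : {fset X}) z k :
  (forall x, x \in t -> f x 0 k <= z) ->
  forall y, y \in (c' @` t)%fset -> g y 0 k <= z + e_fun.
Proof.
move=> tz _ /imfsetP[x /= xt ->]; apply: le_trans (level_c' x k) _.
by rewrite lerD2r tz.
Qed.

(** The target scale [d] is free: [delta] gives the interleaving map, and [delta - eps] the same map
    landing where [c] is simplicial. *)
Lemma flag_compatible_from d u v : delta - eps <= d -> (forall k, u 0 k + e <= v 0 k) ->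
  flag_compatible c' id (fun t => p (c' @` t)%fset) false
    (rips delta (sublevel f u)) d (sublevel g v).
Proof.
move=> d_ge uv; have td (S t : {fset X}) : (t `<=` S)%fset ->
    (forall x y, x \in S -> y \in S -> mdist x y < delta) ->
    forall x y, x \in t -> y \in t -> mdist x y < delta.
  by move=> /fsubsetP tS Sd x y /tS xS /tS; exact: Sd.
split=> // [S t [_ Su Sd] /flagsP[]|S t t' [_ Su Sd] /flagsP[_ t0] /flagsP[]];
  rewrite imfset_id => tS.
- move=> t0; apply/forallP => k; apply: le_trans (uv k).
  rewrite /e [a + _]addrC addrA; apply: p_level; first exact: image_neq0.
    exact: image_c'_diam (td _ _ tS Sd).
  apply: image_c'_level => b bt.
  by have /forallP/(_ k) := Su b (fsubsetP tS b bt).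
- move=> _ tt'; apply: lt_le_trans d_ge; apply: p_chain.
  + exact: image_neq0.
  + exact: fsubset_image.
  + exact: image_c'_diam (td _ _ tS Sd).
Qed.

(** From scale [delta] only the flag map exists; from scale [delta - eps] it can be deformed to the
    simplicial map [c]. *)
Lemma flag_compatible_to (act : bool) d u v : d <= delta -> (act -> d <= delta - eps) ->
  (forall k, u 0 k + e <= v 0 k) ->
  flag_compatible c id (fun t => c (p t)) act
    (rips d (sublevel g u)) delta (sublevel f v).
Proof.
move=> d_le act_d uv; have td (S t : {fset Y}) : (t `<=` S)%fset ->
    (forall x y, x \in S -> y \in S -> mdist x y < d) ->
    forall x y, x \in t -> y \in t -> mdist x y < delta + eps.
  move=> /fsubsetP tS Sd x y /tS xS /tS yS; apply: lt_le_trans (Sd _ _ xS yS) _.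
  by rewrite (le_trans d_le) // lerDl.
split.
- move=> S t [_ Su Sd] /flagsP[]; rewrite imfset_id => tS t0.
  apply/forallP => k; apply: le_trans (uv k); rewrite /e addrA.
  apply: le_trans (level_c _ k) _; rewrite lerD2r.
  apply: p_level => // [|b bt]; first exact: td Sd.
  by have /forallP/(_ k) := Su b (fsubsetP tS b bt).
- move=> S t t' [_ Su Sd] /flagsP[_ t0] /flagsP[]; rewrite imfset_id => tS _ tt'.
  by apply: le_lt_trans (dist_c _ _) _; rewrite -ltrBrDr; apply: p_chain => //; exact: td Sd.
- move=> _ S b [_ Su Sd] bS; apply/forallP => k; apply: le_trans (uv k).
  apply: le_trans (level_c _ k) _; rewrite /e [a + _]addrC addrA.
  apply: (@le_trans _ _ (u 0 k + e_fun)); last by rewrite lerDl.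
  by rewrite lerD2r; have /forallP/(_ k) := Su b bS.
- move=> actT S b b' [_ Su Sd] bS bS'; apply: le_lt_trans (dist_c _ _) _.
  by rewrite -ltrBrDr; apply: lt_le_trans (act_d actT); exact: Sd.
- move=> actT S b t [_ Su Sd] bS /flagsP[]; rewrite imfset_id => tS t0 bt.
  by apply: le_lt_trans (dist_c _ _) _; rewrite -ltrBrDr; apply: p_near => //; exact: td Sd.
Qed.

Lemma flag_compatible_contract (act : bool) d d2 u v : d <= delta -> (act -> d <= d2) ->
  delta - eps <= d2 -> (forall k, u 0 k + a <= v 0 k) ->
  flag_compatible id id p act (rips d (sublevel g u)) d2 (sublevel g v).
Proof.
move=> d_le act_d d2_ge uv; have td (S t : {fset Y}) : (t `<=` S)%fset ->
    (forall x y, x \in S -> y \in S -> mdist x y < d) ->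
    forall x y, x \in t -> y \in t -> mdist x y < delta + eps.
  move=> /fsubsetP tS Sd x y /tS xS /tS yS; apply: lt_le_trans (Sd _ _ xS yS) _.
  by rewrite (le_trans d_le) // lerDl.
split.
- move=> S t [_ Su Sd] /flagsP[]; rewrite imfset_id => tS t0.
  apply/forallP => k; apply: le_trans (uv k); apply: p_level => // [|b bt]; first exact: td Sd.
  by have /forallP/(_ k) := Su b (fsubsetP tS b bt).
- move=> S t t' [_ Su Sd] /flagsP[_ t0] /flagsP[]; rewrite imfset_id => tS _ tt'.
  by apply: lt_le_trans d2_ge; apply: p_chain => //; exact: td Sd.
- move=> _ S b [_ Su Sd] bS; apply/forallP => k; apply: le_trans (uv k).
  by apply: le_trans (sublevel_coord k (Su b bS)) _; rewrite lerDl.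
- by move=> actT S b b' [_ Su Sd] bS bS'; apply: lt_le_trans (act_d actT); exact: Sd.
- move=> actT S b t [_ Su Sd] bS /flagsP[]; rewrite imfset_id => tS t0 bt.
  by apply: lt_le_trans d2_ge; apply: p_near => //; exact: td Sd.
Qed.

Lemma flag_compatible_round_trip u v : (forall k, u 0 k + a + 2 * e_fun <= v 0 k) ->
  flag_compatible id id (fun t => c (p (c' @` t)%fset)) true
    (rips delta (sublevel f u)) delta (sublevel f v).
Proof.
move=> uv; have td (S t : {fset X}) : (t `<=` S)%fset ->
    (forall x y, x \in S -> y \in S -> mdist x y < delta) ->
    forall x y, x \in t -> y \in t -> mdist x y < delta.
  by move=> /fsubsetP tS Sd x y /tS xS /tS; exact: Sd.
split.
- move=> S t [_ Su Sd] /flagsP[]; rewrite imfset_id => tS t0.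
  apply/forallP => k; apply: le_trans (uv k); apply: le_trans (level_c _ k) _.
  have : g (p (c' @` t)%fset) 0 k <= u 0 k + e_fun + a; last by lra.
  apply: p_level; [exact: image_neq0|exact: image_c'_diam (td _ _ tS Sd)|].
  apply: image_c'_level => b bt.
  by have /forallP/(_ k) := Su b (fsubsetP tS b bt).
- move=> S t t' [_ Su Sd] /flagsP[_ t0] /flagsP[]; rewrite imfset_id => tS _ tt'.
  apply: le_lt_trans (dist_c _ _) _; rewrite -ltrBrDr; apply: p_chain.
  + exact: image_neq0.
  + exact: fsubset_image.
  + exact: image_c'_diam (td _ _ tS Sd).
- move=> _ S b [_ Su Sd] bS; apply/forallP => k; apply: le_trans (uv k).
  apply: le_trans (sublevel_coord k (Su b bS)) _.
  by rewrite -addrA lerDl addr_ge0 // mulr_ge0.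
- by move=> _ S b b' [_ Su Sd] bS bS'; exact: Sd.
- move=> _ S b t [_ Su Sd] bS /flagsP[]; rewrite imfset_id => tS t0 bt.
  apply: le_lt_trans (dist_mixed _ _) _; rewrite -ltrBrDr; apply: p_near.
    exact: in_imfset.
  exact: image_c'_diam (td _ _ tS Sd).
Qed.

(** Flags are taken among images under [c], so a vertex b is compared with a centre near c' (c b);
    [dist_back] bridges the two. *)
Lemma flag_compatible_image u v : (forall k, u 0 k + a + 2 * e_fun <= v 0 k) ->
  flag_compatible id c (fun t => p (c' @` t)%fset) true
    (rips (delta - eps) (sublevel g u)) delta (sublevel g v).
Proof.
move=> uv; have td (S : {fset Y}) (t : {fset X}) : (t `<=` c @` S)%fset ->
    (forall x y, x \in S -> y \in S -> mdist x y < delta - eps) ->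
    forall x y, x \in t -> y \in t -> mdist x y < delta.
  move=> /fsubsetP tS Sd _ _ /tS/imfsetP[x /= xS ->] /tS/imfsetP[y /= yS ->].
  by apply: le_lt_trans (dist_c _ _) _; rewrite -ltrBrDr Sd.
split.
- move=> S t [_ Su Sd] /flagsP[tS t0].
  apply/forallP => k; apply: le_trans (uv k).
  have : g (p (c' @` t)%fset) 0 k <= u 0 k + e_fun + e_fun + a; last by lra.
  apply: p_level; [exact: image_neq0|exact: image_c'_diam (td _ _ tS Sd)|].
  apply: image_c'_level => b /(fsubsetP tS)/imfsetP[y /= yS ->].
  apply: le_trans (level_c _ k) _; rewrite lerD2r.
  by have /forallP/(_ k) := Su y yS.
- move=> S t t' [_ Su Sd] /flagsP[_ t0] /flagsP[tS _] tt'.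
  apply: (@lt_le_trans _ _ (delta - eps)); last by rewrite lerBlDr lerDl.
  apply: p_chain; [exact: image_neq0|exact: fsubset_image|].
  exact: image_c'_diam (td _ _ tS Sd).
- move=> _ S b [_ Su Sd] bS; apply/forallP => k; apply: le_trans (uv k).
  apply: le_trans (sublevel_coord k (Su b bS)) _.
  by rewrite -addrA lerDl addr_ge0 // mulr_ge0.
- move=> _ S b b' [_ Su Sd] bS bS'; apply: lt_le_trans (Sd _ _ bS bS') _.
  by rewrite lerBlDr lerDl.
- move=> _ S b t [_ Su Sd] bS /flagsP[tS t0] bt.
  apply: le_lt_trans (dist_back _ _) _; rewrite -ltrBrDr; apply: p_near.
    exact: in_imfset.
  exact: image_c'_diam (td _ _ tS Sd).
Qed.

(** From [X], contract into scale [delta - eps], deform the second map to [c], then deform the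
    resulting flag map to the inclusion. From [Y], contract first, deform the round trip through [X]
    to the inclusion, then undo the contraction. *)
Lemma interleaved_of_contraction :
  interleaved e (rips_filtration delta f) (rips_filtration delta g).
Proof.
have e0 : 0 <= e by rewrite /e addr_ge0.
have de : delta - eps <= delta by rewrite lerBlDr lerDl.
have C1 d (d_ge : delta - eps <= d) u : flag_compatible c' id (fun t => p (c' @` t)%fset) false
    (rips delta (sublevel f u)) d (sublevel g (u + const_mx e)).
  by apply: flag_compatible_from => // k; rewrite !mxE.
have C2 u : flag_compatible c id (fun t => c (p t)) false
    (rips delta (sublevel g u)) delta (sublevel f (u + const_mx e)).
  by apply: flag_compatible_to => // k; rewrite !mxE.
have C3 u : flag_compatible c id (fun t => c (p t)) true
    (rips (delta - eps) (sublevel g (u + const_mx e))) delta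
    (sublevel f (u + const_mx e + const_mx e)).
  by apply: flag_compatible_to => // k; rewrite !mxE.
have e2 u k : u 0 k + a + 2 * e_fun <= (u + const_mx e + const_mx e) 0 k.
  by have := a0; rewrite !mxE /e; move: (u 0 k) => z; lra.
have C4 u : flag_compatible id id (fun t => c (p (c' @` t)%fset)) true
    (rips delta (sublevel f u)) delta (sublevel f (u + const_mx e + const_mx e)).
  by apply: flag_compatible_round_trip => k; exact: e2.
have C5 u : flag_compatible id id p false (rips delta (sublevel g u)) (delta - eps)
    (sublevel g (u + const_mx a)).
  by apply: flag_compatible_contract => // k; rewrite !mxE.
have C6 u : flag_compatible id c (fun t => p (c' @` t)%fset) true
    (rips (delta - eps) (sublevel g (u + const_mx a))) delta
    (sublevel g (u + const_mx e + const_mx e)).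
  by apply: flag_compatible_image => k; rewrite !mxE /e; move: (u 0 k) => z; lra.
have C7 u : flag_compatible id id p true (rips delta (sublevel g u)) delta
    (sublevel g (u + const_mx e + const_mx e)).
  apply: flag_compatible_contract => // k.
  by have := a0; have := e_fun0; rewrite !mxE /e; move: (u 0 k) => z; lra.
pose PS := persistent_space R N.
pose sec (F : PS) (s : R) : @mor PS F (cylinder F) := cylinder_section F s.
pose F : PS := rips_filtration delta f; pose G : PS := rips_filtration delta g.
pose phi : @mor PS F (pshift N e G) :=
  (flag_transformation (C1 delta de) : @mor PS (cylinder F) _) \oc sec F 0.
pose psi : @mor PS G (pshift N e F) :=
  (flag_transformation C2 : @mor PS (cylinder G) _) \oc sec G 0.
pose h1 : @mor PS (cylinder F) (pshift N e (pshift N e F)) :=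
  two_stage_transformation (C1 _ (lexx _)) C3.
pose h2 : @mor PS (cylinder F) (pshift N e (pshift N e F)) := flag_transformation2 C4.
pose h3 : @mor PS (cylinder G) (pshift N e (pshift N e G)) := two_stage_transformation C5 C6.
pose h4 : @mor PS (cylinder G) (pshift N e (pshift N e G)) := flag_transformation2 C7.
pose s2 (H : PS) : @mor PS H (pshift N e (pshift N e H)) :=
  structure_map e0 (pshift N e H) \oc structure_map e0 H.
have psi_phi1 : fun_mor (pshift N e) psi \oc phi = h1 \oc sec F 1.
  apply: nat_trans_eq => u; apply/continuousEP => x; apply: realization_eq => w.
  pose y := flag_point (C1 _ (lexx _) u) (x, 0).
  pose z := flag_point (C1 delta de u) (x, 0).
  change (flag_point (C2 (u + const_mx e)) (z, 0) w = flag_point (C3 u) (y, 1) w).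
  by have [_ Sy] := suppP y; rewrite (flag_pointE _ (S := supp y)).
have psi_phi2 : h1 \oc sec F 0 = h2 \oc sec F 1.
  apply: nat_trans_eq => u; apply/continuousEP => x; apply: realization_eq => w.
  pose y := flag_point (C1 _ (lexx _) u) (x, 0).
  change (flag_point (C3 u) (y, 0) w = flag_point (C4 u) (x, 1) w).
  have [_ Sy] := suppP y; have [_ Sx] := suppP x.
  (* The second stage has become [c], which only alters the targets of the flags of the first
     stage. *)
  have := flag_map_time0 id c (fun t => c (p t)) w Sy.
  have := flag_map_push id c w Sx Sy.
  rewrite /push => e1 e2'.
  exact: etrans e2' e1.
have psi_phi3 : h2 \oc sec F 0 = s2 F.
  apply: nat_trans_eq => u; apply/continuousEP => x; apply: realization_eq => w.
  change (flag_point (C4 u) (x, 0) w = x w).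
  have [_ Sx] := suppP x.
  exact: etrans (flag_map_time0 id id _ w Sx) (push_id w Sx).
have phi_psi1 : fun_mor (pshift N e) phi \oc psi = h3 \oc sec G 1.
  apply: nat_trans_eq => u; apply/continuousEP => x; apply: realization_eq => w.
  pose y := flag_point (C5 u) (x, 0).
  pose z := flag_point (C2 u) (x, 0).
  change (flag_point (C1 delta de (u + const_mx e)) (z, 0) w = flag_point (C6 u) (y, 1) w).
  have [_ Sy] := suppP y; have [_ Sx] := suppP x.
  (* [psi] is the contraction of [Y] followed by the simplicial map [c], so [phi] after it is one
     flag map evaluated at [y], with [j] equal to [c]. *)
  have zE : bary z = push c (supp y) y.
    by apply/funext => v; apply/esym; exact: (flag_map_push c c v Sx Sy).
  have Sz : in_closed_simplex (c @` supp y)%fset z by rewrite zE; exact: push_simplex.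
  by rewrite (flag_pointE _ _ _ Sz) zE; apply/esym; exact: flag_map_pushforward.
have phi_psi2 : h3 \oc sec G 0 = h4 \oc sec G 1.
  apply: nat_trans_eq => u; apply/continuousEP => x; apply: realization_eq => w.
  pose y := flag_point (C5 u) (x, 0).
  change (flag_point (C6 u) (y, 0) w = flag_point (C7 u) (x, 1) w).
  have [_ Sy] := suppP y.
  exact: etrans (flag_map_time0 c id _ w Sy) (push_id w Sy).
have phi_psi3 : h4 \oc sec G 0 = s2 G.
  apply: nat_trans_eq => u; apply/continuousEP => x; apply: realization_eq => w.
  change (flag_point (C7 u) (x, 0) w = x w).
  have [_ Sx] := suppP x.
  exact: etrans (flag_map_time0 id id _ w Sx) (push_id w Sx).
exact: (interleaved_of_homotopies psi_phi1 psi_phi2 psi_phi3 phi_psi1 phi_psi2 phi_psi3).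
Qed.

End Interleaving.

Theorem theorem1p5 (R : realType) (N : nat) (kappa : R) (M : metricType R)
    (f : M -> 'rV[R]_N) (L_f delta : R) (rho : \bar R) (e_met e_fun : R)
    (M_complete : complete_metric M)
    (M_curv : curvature_bounded_above M kappa)
    (L_f_ge0 : 0 <= L_f)
    (f_lip : forall x y : M, `|f x - f y| <= L_f * mdist x y)
    (delta_gt0 : 0 < delta)
    (delta_rho : (delta%:E <= rho)%E)
    (rho_le : (rho <= cat_radius M kappa)%E)
    (jung_gt0 : 0 < jung M rho)
    (e_met_ge0 : 0 <= e_met)
    (e_met_rho : (e_met%:E <= rho - delta%:E)%E)
    (e_met_jung : e_met <= (1 - jung M rho) / (1 + jung M rho) * delta)
    (e_fun_ge0 : 0 <= e_fun) :
  forall (MM : metricType R) (ff : MM -> 'rV[R]_N) (C : set (MM * M)),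
    correspondence e_met e_fun ff f C ->
    interleaved (L_f * jung_slope M rho * e_met + e_fun)
      (rips_filtration delta ff) (rips_filtration delta f).
Proof.
move=> MM ff C [/choice[c' c'C] /choice[c cC] Cd Cf].
have der : ((delta + e_met)%:E <= rho)%E by rewrite EFinD addeC -leeBrDr.
have [p pP] := partial_centers der rho_le delta_gt0 e_met_ge0 jung_gt0 e_met_jung.
have slope0 : 0 <= jung_slope M rho.
  by rewrite /jung_slope divr_ge0 ?mulr_ge0 ?(ltW jung_gt0) // subr_ge0 jung_le1.
apply: (@interleaved_of_contraction _ _ _ _ ff f c' c p delta e_met) => //.
- by apply: mulr_ge0 => //; exact: mulr_ge0.
- move=> x y; have := Cd x y (c' x) (c' y) (c'C x) (c'C y).
  by rewrite ler_norml; lra.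
- move=> x y; have := Cd (c x) (c y) x y (cC x) (cC y).
  by rewrite ler_norml; lra.
- move=> x y; have := Cd x (c y) (c' x) y (c'C x) (cC y).
  by rewrite ler_norml; lra.
(* Both x and c' (c x) correspond to c x, so they are at distance at most [e_met]. *)
- move=> x y; have := Cd (c x) (c x) x (c' (c x)) (cC x) (c'C (c x)).
  have := metric_triangle x (c' (c x)) y.
  by rewrite mdistxx sub0r normrN ger0_norm ?mdist_ge0 //; lra.
- by move=> x k; exact/row_norm_coord/Cf.
- by move=> x k; apply: row_norm_coord; rewrite distrC; exact: Cf.
(* One vertex near [p t] is enough, as the level bound holds at every vertex and f is Lipschitz. *)
- move=> t z k t0 td tz; have [[x xt xp] _ _] := pP t t0 td.
  apply: le_trans (row_norm_coord k (f_lip x (p t))) _.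
  by apply: lerD; [exact: tz|rewrite -mulrA ler_wpM2l].
- move=> t b bt td; have t0 : t != fset0 by apply/fset0Pn; exists b.
  by have [_ + _] := pP t t0 td; exact.
- move=> t t' t0 tt' td; have t0' : t' != fset0.
    by have [x xt] := fset0Pn _ t0; apply/fset0Pn; exists x; exact: (fsubsetP tt').
  by have [_ _] := pP t' t0' td; exact.
Qed.
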